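(* Let $\mathcal H,\mathcal K$ be Hilbert spaces, let $A,B$ be positive definite bounded linear operators on $\mathcal H$ such that $0<m\le A,B\le M$ for scalars $m,M$, and let $\Phi:\mathcal B(\mathcal H)\to\mathcal B(\mathcal K)$ be a positive unital linear mapping. Then for $0\le t\le 1$, \[\Phi(A)\natural_t\Phi(B)\le \frac{1}{K^2\left(\frac{m}{M},\frac{M}{m},t\right)}\left(\frac{M+m}{2\sqrt{Mm}}\right)^{2t}\frac{\left(M^{1+t}+m^{1+t}\right)^2}{4M^{1+t}m^{1+t}}\,\Phi(A\natural_t B).\]
   Context: $\mathcal B(\mathcal H)$ is the algebra of bounded linear operators on $\mathcal H$. For real scalars, $m\le A\le M$ means $mI\le A\le MI$ in the usual order on self-adjoint operators ($A\ge B$ iff $A-B$ is positive semi-definite); ''$m\le A,B\le M$'' means this holds for both $A$ and $B$. A linear map $\Phi$ is positive if $A\ge 0$ implies $\Phi(A)\ge0$, and unital if $\Phi(I)=I$. For positive definite $A,B$, $A\sharp B=A^{1/2}(A^{-1/2}BA^{-1/2})^{1/2}A^{1/2}$, and for $0\le t\le1$ the weighted spectral geometric mean is $A\natural_t B=(A^{-1}\sharp B)^{t}A(A^{-1}\sharp B)^{t}$. The generalized Kantorovich constant is, for $0<a<b$ and $t\in\mathbb R$, \[K(a,b,t)=\frac{ab^t-ba^t}{(t-1)(b-a)}\left(\frac{t-1}{t}\,\frac{b^t-a^t}{ab^t-ba^t}\right)^t,\] with the value $1$ (the limiting value) when $t\in\{0,1\}$ or $a=b$. $K^2(\cdot)$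 denotes the square of $K(\cdot)$. *)

(* Defs.v *)
From HB Require Import structures.
From mathcomp Require Import all_boot all_order all_algebra.
From mathcomp Require Import complex.
From mathcomp Require Import all_classical all_reals all_analysis.

Set Implicit Arguments.
Unset Strict Implicit.
Unset Printing Implicit Defensive.

Import Order.TTheory GRing.Theory Num.Theory.
Import numFieldNormedType.Exports.

Local Open Scope classical_set_scope.
Local Open Scope ring_scope.
Local Open Scope complex_scope.

(* Complex Hilbert spaces. A form of type {dot H for Num.conj} is linear in
   its first argument and conjugate-linear in its second one. *)
HB.mixin Record CompleteNormedModule_isHilbert (R : realType) H
    & @CompleteNormedModule R[i] H := {
  inner : {dot H for @Num.conj R[i]};
  norm_inner : forall x : H, `|x| ^+ 2 = inner x x
}.

#[short(type="hilbertType")]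
HB.structure Definition Hilbert (R : realType) :=
  {H of @CompleteNormedModule R[i] H & CompleteNormedModule_isHilbert R H}.

Section BoundedOperators.
Variables (R : realType) (H : hilbertType R).

Definition is_bounded_operator (f : H -> H) : Prop :=
  (forall (a : R[i]) (x y : H), f (a *: x + y) = a *: f x + f y) /\
  (exists k : R[i], forall x : H, `|f x| <= k * `|x|).

Definition bounded_operator : {pred H -> H} :=
  fun f => `[< is_bounded_operator f >].

Lemma bounded_operatorP f :
  reflect (is_bounded_operator f) (f \in bounded_operator).
Proof. exact: asboolP. Qed.

Lemma bounded_operator_submod : submod_closed bounded_operator.
Proof.
split=> [|a f g].
  apply/bounded_operatorP; split=> [b x y|]; first by rewrite scaler0 addr0.
  by exists 0 => x; rewrite normr0 mul0r.
move=> /bounded_operatorP [fl [k fk]] /bounded_operatorP [gl [l gk]].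
apply/bounded_operatorP; split=> [b x y|].
  change (a *: f (b *: x + y) + g (b *: x + y) =
          b *: (a *: f x + g x) + (a *: f y + g y)).
  by rewrite fl gl !scalerDr !scalerA (mulrC a) !addrA; congr (_ + _);
    rewrite -!addrA; congr (_ + _); rewrite addrC.
exists (`|a| * k + l) => x; change (`|a *: f x + g x| <= (`|a| * k + l) * `|x|).
rewrite (le_trans (ler_normD _ _)) // mulrDl lerD // normrZ -mulrA.
by rewrite ler_wpM2l.
Qed.

HB.instance Definition _ :=
  GRing.isSubmodClosed.Build R[i] (H -> H) bounded_operator
    bounded_operator_submod.

Record bop := BOp { bop_fun :> H -> H; _ : bop_fun \in bounded_operator }.

HB.instance Definition _ := [isSub for bop_fun].
HB.instance Definition _ := [Choice of bop by <:].
HB.instance Definition _ := [SubChoice_isSubLmodule of bop by <:].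

Lemma bop_linear (A : bop) (a : R[i]) (x y : H) :
  A (a *: x + y) = a *: A x + A y.
Proof. by case: A => f /= /bounded_operatorP [fl _]; exact: fl. Qed.

Lemma bop_bounded (A : bop) : exists k : R[i], forall x : H, `|A x| <= k * `|x|.
Proof. by case: A => f /= /bounded_operatorP []. Qed.

Lemma bop_ext (A B : bop) : (forall x, A x = B x) -> A = B.
Proof. by move=> AB; apply/val_inj/funext. Qed.

Lemma bop_one_subproof : @id H \in bounded_operator.
Proof. by apply/bounded_operatorP; split=> //; exists 1 => x; rewrite mul1r. Qed.

Lemma bop_mul_subproof (A B : bop) : A \o B \in bounded_operator.
Proof.
apply/bounded_operatorP; split=> [a x y|] /=; first by rewrite !bop_linear.
have [k Ak] := bop_bounded A; have [l Bl] := bop_bounded B.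
exists (`|k| * `|l|) => x /=.
have le_norm (c y : R[i]) (u : R[i]) : 0 <= y -> 0 <= u -> u <= c * y ->
    u <= `|c| * y.
  move=> y0 u0 uc; rewrite -(ger0_norm y0) -normrM -(ger0_norm u0).
  by rewrite ger0_norm // (le_trans uc) // real_ler_norm // ger0_real
    // (le_trans u0 uc).
apply: (le_trans (le_norm k `|B x| _ _ _ (Ak (B x)))) => //.
by rewrite -mulrA ler_wpM2l // le_norm.
Qed.

Definition bop_one : bop := BOp bop_one_subproof.
Definition bop_mul (A B : bop) : bop := BOp (bop_mul_subproof A B).

Lemma bop_mulA : associative bop_mul.
Proof. by move=> A B C; apply: bop_ext. Qed.
Lemma bop_mul1 : left_id bop_one bop_mul.
Proof. by move=> A; apply: bop_ext. Qed.
Lemma bop_mulr1 : right_id bop_one bop_mul.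
Proof. by move=> A; apply: bop_ext. Qed.
Lemma bop_mulDl : left_distributive bop_mul +%R.
Proof. by move=> A B C; apply: bop_ext. Qed.
Lemma bop_mulDr : right_distributive bop_mul +%R.
Proof.
move=> A B C; apply: bop_ext => x /=.
by have := bop_linear A 1 (B x) (C x); rewrite !scale1r.
Qed.

HB.instance Definition _ := GRing.Zmodule_isPzRing.Build bop
  bop_mulA bop_mul1 bop_mulr1 bop_mulDl bop_mulDr.

End BoundedOperators.

Arguments bop {R} H.

Section OperatorTheory.
Variables (R : realType) (H : hilbertType R).
Implicit Types (A B F S : bop H) (f : R -> R) (s t : R).

Definition self_adjoint A : Prop := forall x y : H, inner (A x) y = inner x (A y).

(* In R[i], 0 <= z means that z is real and nonnegative. *)
Definition psd A : Prop := self_adjoint A /\ forall x : H, 0 <= inner (A x) x.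

Definition bop_le A B : Prop := psd (B - A).

Definition is_inverse A S : Prop := S * A = 1 /\ A * S = 1.

Definition posdef A : Prop := psd A /\ exists S, is_inverse A S.

(* 0 when A is not invertible. *)
Definition bop_inv A : bop H := xget 0 [set S | is_inverse A S].

(* The real points of the spectrum, i.e., the whole spectrum if A is
   self-adjoint. *)
Definition spectrum A : set R :=
  [set s : R | ~ exists S, is_inverse (A - s%:C *: (1 : bop H)) S].

Definition bop_horner (p : {poly R}) A : bop H :=
  \sum_(i < size p) (p`_i)%:C *: A ^+ i.

(* Convergence in operator norm. *)
Definition bop_cvg (F_ : nat -> bop H) F : Prop :=
  forall e : R, 0 < e ->
    \forall n \near \oo, forall x : H, `|(F_ n - F) x| <= e%:C * `|x|.

(* Continuous functional calculus of a self-adjoint A: f(A) is the norm limit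
   of p_n(A) for polynomials p_n converging to f uniformly on the spectrum. *)
Definition is_funcalc f A F : Prop :=
  exists p : nat -> {poly R},
    (forall e : R, 0 < e ->
       \forall n \near \oo, forall s, spectrum A s -> `|(p n).[s] - f s| <= e) /\
    bop_cvg (fun n => bop_horner (p n) A) F.

(* Meaningful if A is self-adjoint and f is continuous on its spectrum. *)
Definition funcalc f A : bop H := xget 0 [set F | is_funcalc f A F].

Definition bop_pow A t : bop H := funcalc (fun s => s `^ t) A.

Definition geo_mean A B : bop H :=
  bop_pow A 2^-1
  * bop_pow (bop_pow A (- 2^-1) * B * bop_pow A (- 2^-1)) 2^-1
  * bop_pow A 2^-1.

Definition spectral_geo_mean t A B : bop H :=
  bop_pow (geo_mean (bop_inv A) B) t * A * bop_pow (geo_mean (bop_inv A) B) t.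

End OperatorTheory.

Definition positive_map (R : realType) (H K : hilbertType R)
    (Phi : bop H -> bop K) : Prop := forall A, psd A -> psd (Phi A).

Definition unital_map (R : realType) (H K : hilbertType R)
    (Phi : bop H -> bop K) : Prop := Phi 1 = 1.

Definition kantorovich (R : realType) (a b t : R) : R :=
  if [|| t == 0, t == 1 | a == b] then 1
  else (a * b `^ t - b * a `^ t) / ((t - 1) * (b - a))
       * ((t - 1) / t * ((b `^ t - a `^ t) / (a * b `^ t - b * a `^ t))) `^ t.

(* Main.v *)
Require Import Defs.
From mathcomp Require Import all_boot all_order all_algebra.
From mathcomp Require Import complex.
From mathcomp Require Import all_classical all_reals all_analysis.
From mathcomp Require Import ring lra.

(* Let E = Phi(A^-1), X = A^-1 # B and Y = Phi(A)^-1 # Phi(B), so that X A X = B and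
   Y Phi(A) Y = Phi(B).

   Upper bound.  (s - m)(M - s) >= 0 on the spectrum of A^1/2 X A^1/2 gives
   B + Mm A^-1 <= (M + m) X.  Applying Phi, Choi's inequality Phi(A)^-1 <= E and the
   AM-GM inequality 2 sqrt(Mm) Y <= Phi(B) + Mm Phi(A)^-1 yield Y <= k Phi(X) with
   k = (M + m) / (2 sqrt(Mm)).  The chord l of s^t on [m/M, M/m] satisfies
   K s^t <= l(s) for all s > 0 and l(s) <= s^t on the interval, hence
   P := Y^t <= c Phi(X^t) with c = k^t / K.  No operator monotonicity is needed.

   Conclusion.  Phi(X^t A X^t) >= 2 s Phi(X^t) - s^2 E for every real s, while
   P Phi(A) P <= P ((M + m) - Mm E) P <= sqrt(Mm) (g + 1/g) P - Mm E with
   g^2 = (M/m)^(1+t), because the spectra of P and sqrt(Mm) E lie in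
   [p^-1, p] with p = (M/m)^(t/2) and [mu^-1, mu] with mu = sqrt(M/m).  The best s
   gives the factor c^2 (g + 1/g)^2 / 4, which is the stated constant. *)

Set Implicit Arguments.
Unset Strict Implicit.
Unset Printing Implicit Defensive.

Import Order.TTheory GRing.Theory Num.Theory.
Import numFieldNormedType.Exports.

Local Open Scope classical_set_scope.
Local Open Scope ring_scope.
Local Open Scope complex_scope.

(** * The underlying real inner product *)

(** No spectral theorem is used. Orders are statements about real quadratic forms, and one bridge
    leads from scalars to operators: a real polynomial that is nonnegative on the spectrum gives a
    nonnegative operator. Norm bounds follow, and with them existence and uniqueness of operator
    powers. Noncommutativity is the obstacle. [Y] and [Phi X] need not commute, so an inequality
    between them does not pass to powers by scalar reasoning; affine functions do pass through
    [Phi], so the chord replaces the power on both sides, and the price of that exchange is K. The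
    optimization in s squares c, hence K. [P] and [E] need not commute either: Cauchy-Schwarz for
    the inverse of [P] replaces a scalar estimate in two variables. [Phi] is only positive, so
    Choi's inequality cannot rest on 2-positivity. It involves functions of the single operator [A],
    and for these a positive partition of unity made of polynomials in [A] suffices. *)

Section RealForm.
Variables (R : realType) (H : hilbertType R).
Implicit Types (x y z : H) (c : R).

(* The real part of the inner product: a real inner product that still
   determines self-adjointness and the order of operators. *)
Definition rip x y : R := complex.Re (inner x y).
Definition vnorm x : R := complex.Re `|x|.

Lemma Re_complexD (z w : R[i]) :
  complex.Re (z + w) = complex.Re z + complex.Re w.
Proof. by case: z; case: w. Qed.

Lemma Re_complexM c (z : R[i]) : complex.Re (c%:C * z) = c * complex.Re z.
Proof. by case: z => a b /=; rewrite mul0r subr0. Qed.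

Lemma ripDl z x y : rip (x + y) z = rip x z + rip y z.
Proof. by rewrite /rip linearDl Re_complexD. Qed.

Lemma ripDr z x y : rip z (x + y) = rip z x + rip z y.
Proof. by rewrite /rip linearDr Re_complexD. Qed.

Lemma ripZl c x y : rip (c%:C *: x) y = c * rip x y.
Proof. by rewrite /rip linearZl_LR Re_complexM. Qed.

Lemma ripC x y : rip x y = rip y x.
Proof.
rewrite /rip (hermC inner) expr0 mul1r /=.
have /(congr1 (@complex.Re R)) := esym (complexRe (inner y x)).
have := addcJ (inner y x); have := complexRe (inner y x).
by rewrite /Num.conj /=; case: (inner y x).
Qed.

Lemma ripZr c x y : rip x (c%:C *: y) = c * rip x y.
Proof. by rewrite ripC ripZl ripC. Qed.

Lemma scale_realN1 x : (-1)%:C *: x = - x.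
Proof. by rewrite rmorphN1 scaleN1r. Qed.

Lemma ripNl x y : rip (- x) y = - rip x y.
Proof. by rewrite -scale_realN1 ripZl mulN1r. Qed.

Lemma ripNr x y : rip x (- y) = - rip x y.
Proof. by rewrite ripC ripNl ripC. Qed.

Lemma ripBl z x y : rip (x - y) z = rip x z - rip y z.
Proof. by rewrite ripDl ripNl. Qed.

Lemma ripBr z x y : rip z (x - y) = rip z x - rip z y.
Proof. by rewrite ripDr ripNr. Qed.

Lemma rip0l x : rip 0 x = 0.
Proof. by rewrite -(subrr x) ripBl subrr. Qed.

Lemma rip0r x : rip x 0 = 0.
Proof. by rewrite ripC rip0l. Qed.

Lemma rip_suml I (r : seq I) (P : pred I) (F : I -> H) x :
  rip (\sum_(i <- r | P i) F i) x = \sum_(i <- r | P i) rip (F i) x.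
Proof.
by apply: (big_morph (rip^~ x)) => [y z|]; rewrite ?ripDl ?rip0l.
Qed.

Lemma vnormE x : `|x| = (vnorm x)%:C.
Proof. by rewrite /vnorm RRe_real // ger0_real. Qed.

Lemma vnorm_ge0 x : 0 <= vnorm x.
Proof. by rewrite -ler0c -vnormE. Qed.

Lemma vnormD x y : vnorm (x + y) <= vnorm x + vnorm y.
Proof. by rewrite -lecR rmorphD /= -!vnormE ler_normD. Qed.

Lemma vnormN x : vnorm (- x) = vnorm x.
Proof. by rewrite /vnorm normrN. Qed.

Lemma vnormB x y : vnorm (x - y) <= vnorm x + vnorm y.
Proof. by rewrite -(vnormN y) vnormD. Qed.

Lemma vnorm0 : vnorm 0 = 0.
Proof. by rewrite /vnorm normr0. Qed.

Lemma vnorm_eq0 x : vnorm x = 0 -> x = 0.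
Proof. by move=> x0; apply/normr0_eq0; rewrite vnormE x0. Qed.

Lemma ripxx x : rip x x = vnorm x ^+ 2.
Proof. by rewrite /rip -norm_inner vnormE -rmorphXn. Qed.

Lemma ripxx_ge0 x : 0 <= rip x x.
Proof. by rewrite ripxx sqr_ge0. Qed.

Lemma rip_eq0 x : rip x x = 0 -> x = 0.
Proof. by rewrite ripxx => /eqP; rewrite sqrf_eq0 => /eqP/vnorm_eq0. Qed.

End RealForm.

Lemma quad_ge0_discr (R : realFieldType) (a b c : R) : 0 <= c ->
  (forall s : R, 0 <= a + 2 * s * b + s ^+ 2 * c) -> b ^+ 2 <= a * c.
Proof.
move=> c0 abc; have [c_eq0|c_neq0] := eqVneq c 0.
  have [->|b_neq0] := eqVneq b 0; first by rewrite c_eq0 expr0n mulr0.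
  (* For [c = 0] the form is affine in [s], and at this [s] it equals -1: a contradiction unless [b]
     vanishes. *)
  have := abc (- (a + 1) / (2 * b)).
  have -> : 2 * (- (a + 1) / (2 * b)) * b = - (a + 1) by field.
  by rewrite c_eq0 mulr0; lra.
have := abc (- b / c).
have -> : a + 2 * (- b / c) * b + (- b / c) ^+ 2 * c = (a * c - b ^+ 2) / c.
  by field.
by rewrite pmulr_lge0 ?subr_ge0 // invr_gt0 lt_def c_neq0.
Qed.

(** * Bounded operators and their quadratic forms *)

Section Operators.
Variables (R : realType) (H : hilbertType R).
Implicit Types (x y z : H) (A B S : bop H) (c k : R).

Lemma bopD A x y : A (x + y) = A x + A y.
Proof. by have := bop_linear A 1 x y; rewrite !scale1r. Qed.

Lemma bop0 A : A 0 = 0.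
Proof. by apply: (addrI (A 0)); rewrite -bopD !addr0. Qed.

Lemma bopZ A (a : R[i]) x : A (a *: x) = a *: A x.
Proof. by have := bop_linear A a x 0; rewrite bop0 !addr0. Qed.

Lemma bopN A x : A (- x) = - A x.
Proof. by rewrite -scaleN1r bopZ scaleN1r. Qed.

Lemma bopB A x y : A (x - y) = A x - A y.
Proof. by rewrite bopD bopN. Qed.

Lemma bopDE A B x : (A + B) x = A x + B x. Proof. by []. Qed.
Lemma bopNE A x : (- A) x = - A x. Proof. by []. Qed.
Lemma bopBE A B x : (A - B) x = A x - B x. Proof. by []. Qed.
Lemma bopZE (a : R[i]) A x : (a *: A) x = a *: A x. Proof. by []. Qed.
Lemma bopME A B x : (A * B) x = A (B x). Proof. by []. Qed.
Lemma bop1E x : (1 : bop H) x = x. Proof. by []. Qed.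
Lemma bop0E x : (0 : bop H) x = 0. Proof. by []. Qed.

Lemma bop_sumE I (r : seq I) (P : pred I) (F : I -> bop H) x :
  (\sum_(i <- r | P i) F i) x = \sum_(i <- r | P i) F i x.
Proof. exact: (big_morph (fun A : bop H => A x) (fun A B => bopDE A B x) (bop0E x)). Qed.

Definition bopE := (bopDE, bopNE, bopZE, bopME, bop1E, bop0E).
Definition ripE := (ripDl, ripDr, ripNl, ripNr, ripZl, ripZr).

Lemma bop_scaleAl (a : R[i]) A B : (a *: A) * B = a *: (A * B).
Proof. by apply: bop_ext. Qed.

Lemma bop_scaleAr (a : R[i]) A B : A * (a *: B) = a *: (A * B).
Proof. by apply: bop_ext => x; rewrite !bopE bopZ. Qed.

(** Operator norms enter only as upper bounds, so no supremum has to be formed. *)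
Definition norm_le A k := forall x, vnorm (A x) <= k * vnorm x.

Lemma norm_leP A k :
  norm_le A k <-> forall x : H, `|A x| <= k%:C * `|x|.
Proof.
by split=> Ak x; have := Ak x; rewrite !vnormE -rmorphM /= lecR.
Qed.

(** The bound in [bop_bounded] is a complex number; an inequality in [R[i]] implies the one between
    real parts, so the absolute value of its real part works. *)
Lemma bop_norm_le A : exists2 k, 0 <= k & norm_le A k.
Proof.
have [k Ak] := bop_bounded A; exists `|complex.Re k| => // x.
have := Ak x; rewrite !vnormE lecE => /andP[_] /=; case: k {Ak} => a b /=.
rewrite mulr0 subr0 => /le_trans; apply.
by rewrite ler_wpM2r ?vnorm_ge0 ?ler_norm.
Qed.

Lemma norm_leD A B k l : norm_le A k -> norm_le B l -> norm_le (A + B) (k + l).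
Proof.
move=> Ak Bl x; rewrite mulrDl; apply: le_trans (vnormD _ _) _.
exact: lerD (Ak x) (Bl x).
Qed.

Lemma norm_leN A k : norm_le A k -> norm_le (- A) k.
Proof. by move=> Ak x; rewrite bopNE vnormN. Qed.

Lemma norm_leM A B k l :
  0 <= k -> norm_le A k -> norm_le B l -> norm_le (A * B) (k * l).
Proof.
move=> k0 Ak Bl x; rewrite -mulrA; apply: le_trans (Ak _) _.
exact: ler_wpM2l (Bl x).
Qed.

Lemma norm_le_trans A k l : k <= l -> norm_le A k -> norm_le A l.
Proof.
move=> kl Ak x; apply: le_trans (Ak x) _.
by rewrite ler_wpM2r ?vnorm_ge0.
Qed.

(** The imaginary part of [inner u v] is the real form at [u] and ['i *: v], and [A] commutes with
    the scalar ['i]. *)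
Lemma self_adjointP A :
  self_adjoint A <-> forall x y, rip (A x) y = rip x (A y).
Proof.
split=> [sA x y|sA x y]; first by rewrite /rip sA.
have ImE (u v : H) : complex.Im (inner u v) = rip u ('i%C *: v).
  rewrite /rip linearZr_LR /= {1}complexiE conjCi -complexiE.
  by case: (inner u v) => a b; simpc.
have := ImE (A x) y; have := ImE x (A y); rewrite -bopZ -sA => <-.
have := sA x y; rewrite /rip.
by case: (inner (A x) y) (inner x (A y)) => a b [c d] /= -> ->.
Qed.

Lemma inner_real A x : self_adjoint A -> inner (A x) x = (rip (A x) x)%:C.
Proof.
move=> sA; rewrite RRe_real //; apply/CrealP.
by have := hermC inner (A x) x; rewrite expr0 mul1r /= => {2}->; rewrite sA.
Qed.

Lemma psdP A : psd A <-> self_adjoint A /\ forall x, 0 <= rip (A x) x.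
Proof.
split=> -[sA pA]; split=> // x; have := pA x; rewrite inner_real ?ler0c //.
Qed.

Lemma self_adjointD A B : self_adjoint A -> self_adjoint B -> self_adjoint (A + B).
Proof. by move=> sA sB x y; rewrite linearDl linearDr /= sA sB. Qed.

Lemma self_adjointZ c A : self_adjoint A -> self_adjoint (c%:C *: A).
Proof.
move=> /self_adjointP sA; apply/self_adjointP => x y.
by rewrite !bopE ripZl ripZr sA.
Qed.

Lemma self_adjointN A : self_adjoint A -> self_adjoint (- A).
Proof.
by move=> /self_adjointP sA; apply/self_adjointP => x y; rewrite !bopE !ripE sA.
Qed.

Lemma self_adjointB A B : self_adjoint A -> self_adjoint B -> self_adjoint (A - B).
Proof. by move=> sA sB; apply/self_adjointD/self_adjointN. Qed.

Lemma self_adjoint1 : self_adjoint (1 : bop H). Proof. by []. Qed.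

Lemma self_adjoint0 : self_adjoint (0 : bop H).
Proof. by move=> x y; rewrite linear0l linear0r. Qed.

Lemma self_adjointM A B :
  self_adjoint A -> self_adjoint B -> A * B = B * A -> self_adjoint (A * B).
Proof. by move=> sA sB AB x y; rewrite {1}AB /= sB sA. Qed.

Lemma self_adjoint_conj A B :
  self_adjoint A -> self_adjoint B -> self_adjoint (B * A * B).
Proof. by move=> sA sB x y; rewrite /= sB sA sB. Qed.

Lemma bop_leP A B : self_adjoint A -> self_adjoint B ->
  bop_le A B <-> forall x, rip (A x) x <= rip (B x) x.
Proof.
move=> sA sB; rewrite /bop_le psdP; split=> [[_ AB] x|AB].
  by have := AB x; rewrite bopBE ripBl subr_ge0.
split=> [|x]; first exact: self_adjointB.
by rewrite bopBE ripBl subr_ge0.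
Qed.

(** The form of [A] is nonnegative along the line [x + s y], so its discriminant in [s] is
    nonpositive. *)
Lemma psd_cauchy A x y : self_adjoint A -> (forall x, 0 <= rip (A x) x) ->
  rip (A x) y ^+ 2 <= rip (A x) x * rip (A y) y.
Proof.
move=> /self_adjointP sA A0; apply: quad_ge0_discr => // s.
have := A0 (x + s%:C *: y); rewrite bopD bopZ !ripE (sA y x) (ripC y (A x)).
by rewrite (_ : _ + _ = rip (A x) x + 2 * s * rip (A x) y
  + s ^+ 2 * rip (A y) y) //; ring.
Qed.

Lemma rip_cauchy x y : rip x y <= vnorm x * vnorm y.
Proof.
have xy0 : 0 <= vnorm x * vnorm y by rewrite mulr_ge0 ?vnorm_ge0.
have [|/ltW xy] := leP 0 (rip x y); last exact: le_trans xy xy0.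
move=> xy; rewrite -(ler_pXn2r (ltn0Sn 1)) ?nnegrE // exprMn -!ripxx.
exact: (@psd_cauchy 1 x y self_adjoint1 (@ripxx_ge0 _ _)).
Qed.

End Operators.

(** * Norm completeness and inverses *)

Section Completeness.
Variables (R : realType) (H : hilbertType R).
Implicit Types (x y z : H) (A B S T : bop H).

(** Balls of a complex normed space have radii in [R[i]]; a positive one is real, so the estimates
    can be made in [R]. *)
Lemma complex_gt0 (e : R[i]) : 0 < e -> 0 < complex.Re e /\ e = (complex.Re e)%:C.
Proof. by case: e => a b; rewrite ltcE /= => /andP[/eqP -> a0]. Qed.

Lemma hilbert_complete (u : nat -> H) :
  (forall e : R, 0 < e -> exists N, forall n p, (N <= n)%N -> (N <= p)%N ->
     vnorm (u n - u p) <= e) ->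
  exists l, forall e : R, 0 < e ->
    exists N, forall n, (N <= n)%N -> vnorm (u n - l) <= e.
Proof.
move=> u_cauchy.
have /cauchy_cvg ul : cauchy (u @ \oo).
  apply: cauchy_exP => e /complex_gt0[e0 ->].
  have [N uN] := u_cauchy (complex.Re e / 2) (divr_gt0 e0 (ltr0n _ 2)).
  exists (u N); exists N => // n /= Nn.
  rewrite -ball_normE /= vnormE ltcR (le_lt_trans (uN _ _ (leqnn N) Nn)) //.
  by rewrite ltr_pdivrMr // ltr_pMr // ltr1n.
have {ul}[l ul] : exists l : H, u @ \oo --> l by exists (lim (u @ \oo)).
exists l => e e0.
have e0' : 0 < e%:C by rewrite ltcR.
have [N _ Nu] := cvgr_dist_le _ _ ul _ e0'.
exists N => n Nn; have := Nu n Nn; rewrite /= vnormE lecR.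
by rewrite -vnormN opprB.
Qed.

Lemma bop_complete (F : nat -> bop H) :
  (forall e : R, 0 < e -> exists N, forall n p, (N <= n)%N -> (N <= p)%N ->
     norm_le (F n - F p) e) ->
  exists G : bop H, forall e : R, 0 < e ->
    exists N, forall n, (N <= n)%N -> norm_le (F n - G) e.
Proof.
move=> F_cauchy.
have Fx_cvg x : exists l, forall e : R, 0 < e ->
    exists N, forall n, (N <= n)%N -> vnorm (F n x - l) <= e.
  apply: (@hilbert_complete (fun n => F n x)) => e e0.
  have x1 : 0 < vnorm x + 1 by rewrite ltr_wpDl ?vnorm_ge0.
  have [N FN] := F_cauchy _ (divr_gt0 e0 x1).
  exists N => n p Nn Np; apply: le_trans (FN n p Nn Np x) _.
  by rewrite mulrAC ler_pdivrMr // ler_pM2l // lerDl.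
have [g Fg] := choice Fx_cvg.
have Fg_unif e : 0 < e -> exists N, forall n, (N <= n)%N ->
    forall x, vnorm (F n x - g x) <= e * vnorm x.
  move=> e0; have [N FN] := F_cauchy _ e0; exists N => n Nn x.
  apply/ler_addgt0Pr => d d0; have [N' FN'] := Fg x d d0.
  (* The index [maxn N N'] serves both the uniform Cauchy estimate and the pointwise limit at [x];
     the latter costs only the arbitrary [d]. *)
  have -> : F n x - g x = (F n - F (maxn N N')) x + (F (maxn N N') x - g x).
    by rewrite bopE addrA subrK.
  rewrite (le_trans (vnormD _ _)) // lerD ?FN' ?leq_maxr //.
  by apply: FN; rewrite ?leq_maxl.
have g_lin (a : R[i]) x y : g (a *: x + y) = a *: g x + g y.
  apply/eqP; rewrite -subr_eq0; apply/eqP/vnorm_eq0/eqP.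
  rewrite eq_le vnorm_ge0 andbT; apply/ler_addgt0Pr => d d0; rewrite add0r.
  (* Total weight of the three errors made when [g] is replaced by [F N], plus 1 for positivity. *)
  pose k := vnorm (a *: x + y) + vnorm (a *: x) + vnorm y + 1.
  have k0 : 0 < k by rewrite ltr_wpDl ?addr_ge0 ?vnorm_ge0.
  have [N FN] := Fg_unif _ (divr_gt0 d0 k0).
  have -> : g (a *: x + y) - (a *: g x + g y)
    = a *: (F N x - g x) + (F N y - g y) - (F N (a *: x + y) - g (a *: x + y)).
    rewrite bop_linear scalerBr [in RHS]addrACA opprB [in RHS]addrC.
    by rewrite -opprD [RHS]addrACA subrr addr0 addrC.
  have aZ : vnorm (a *: (F N x - g x)) <= d / k * vnorm (a *: x).
    have := FN N (leqnn N) x; rewrite -lecR rmorphM /= -!vnormE.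
    move=> /(ler_wpM2l (normr_ge0 a)); rewrite -normrZ mulrCA -normrZ.
    by rewrite !vnormE -rmorphM lecR.
  have := vnormB (a *: (F N x - g x) + (F N y - g y))
    (F N (a *: x + y) - g (a *: x + y)).
  have := vnormD (a *: (F N x - g x)) (F N y - g y).
  have := FN N (leqnn N) y; have := FN N (leqnn N) (a *: x + y).
  have : d / k * k = d by rewrite divfK // gt_eqF.
  have : 0 < d / k by exact: divr_gt0.
  rewrite /k; lra.
have [N FN] := Fg_unif 1 ltr01.
have [k k0 Fk] := bop_norm_le (F N).
have g_bounded : g \in @bounded_operator R H.
  apply/bounded_operatorP; split=> //; exists (k + 1)%:C => x.
  rewrite !vnormE -rmorphM lecR mulrDl.
  rewrite (_ : g x = F N x - (F N x - g x)); last by rewrite subKr.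
  by rewrite (le_trans (vnormB _ _)) // lerD ?Fk ?FN.
by exists (BOp g_bounded) => e /Fg_unif.
Qed.

(** In operator form, T^2 <= k T. Cauchy-Schwarz for the form of [T] at [x] and [T x] gives |Tx|^4
    <= <Tx,x> <TTx,Tx>; bound the last factor by k |Tx|^2 and divide. *)
Lemma psd_norm_le T k : 0 <= k -> self_adjoint T ->
  (forall x, 0 <= rip (T x) x) -> (forall x, rip (T x) x <= k * rip x x) ->
  forall x, vnorm (T x) ^+ 2 <= k * rip (T x) x.
Proof.
move=> k0 sT T0 Tk x; have := psd_cauchy x (T x) sT T0.
have := Tk (T x); rewrite !ripxx => TTk TT.
have [->|Tx_neq0] := eqVneq (vnorm (T x)) 0.
  by rewrite expr0n /= mulr_ge0.
have Tx_gt0 : 0 < vnorm (T x) ^+ 2.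
  by rewrite exprn_gt0 // lt_def Tx_neq0 vnorm_ge0.
rewrite -(ler_pM2r Tx_gt0) -expr2 (le_trans TT) //.
by have := ler_wpM2l (T0 x) TTk; lra.
Qed.

Lemma bop_norm_eq A B k :
  (forall e : R, 0 < e -> norm_le (A - B) (k * e)) -> A = B.
Proof.
move=> AB; apply/bop_ext => x; apply/eqP; rewrite -subr_eq0; apply/eqP/vnorm_eq0.
apply/eqP; rewrite eq_le vnorm_ge0 andbT; apply/ler_addgt0Pr => e e0.
rewrite add0r; pose c := `|k| * vnorm x + 1.
have c0 : 0 < c by rewrite ltr_wpDl ?mulr_ge0 ?vnorm_ge0.
apply: le_trans (AB _ (divr_gt0 e0 c0) x) _.
have -> : k * (e / c) * vnorm x = e * (k * vnorm x) / c by ring.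
rewrite ler_pdivrMr // ler_pM2l //.
rewrite (@le_trans _ _ (`|k| * vnorm x)) ?lerDl //.
by rewrite ler_wpM2r ?vnorm_ge0 ?ler_norm.
Qed.

(* Neumann series for T = 1 - S / L with L a bound of S. *)
Lemma coercive_invertible S d : self_adjoint S -> 0 < d ->
  (forall x, d * rip x x <= rip (S x) x) -> exists V, is_inverse S V.
Proof.
move=> sS d0 dS; have [L0 L00 SL0] := bop_norm_le S.
(* Adding [d] makes [L] positive and at least [d], so the contraction rate [q] lies in [0, 1). *)
pose L := L0 + d; have L_gt0 : 0 < L by rewrite ltr_wpDl.
have SL x : rip (S x) x <= L * rip x x.
  rewrite ripxx (le_trans (rip_cauchy _ _)) // expr2 mulrA ler_wpM2r ?vnorm_ge0 //.
  by rewrite (le_trans (SL0 x)) // ler_wpM2r ?vnorm_ge0 // lerDl ltW.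
pose q := 1 - d / L; pose T : bop H := 1 - (L^-1)%:C *: S.
have q0 : 0 <= q by rewrite subr_ge0 ler_pdivrMr // mul1r lerDr.
have q1 : q < 1 by rewrite gtrBl divr_gt0.
have sT : self_adjoint T by exact/self_adjointB/self_adjointZ.
have Tx x : rip (T x) x = rip x x - L^-1 * rip (S x) x.
  by rewrite bopBE bopZE bop1E ripBl ripZl.
have T0 x : 0 <= rip (T x) x by rewrite Tx subr_ge0 mulrC ler_pdivrMr // mulrC.
have Tq x : rip (T x) x <= q * rip x x.
  rewrite Tx /q mulrBl mul1r lerD2l lerN2 mulrAC mulrC.
  by rewrite ler_pM2l ?invr_gt0.
have nT : norm_le T q.
  move=> x; rewrite -(ler_pXn2r (ltn0Sn 1)) ?nnegrE ?mulr_ge0 ?vnorm_ge0 //.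
  rewrite (le_trans (psd_norm_le q0 sT T0 Tq x)) // exprMn expr2 -mulrA.
  by rewrite ler_wpM2l // -ripxx.
have ST : S = L%:C *: (1 - T).
  by rewrite subKr scalerA -rmorphM divff ?gt_eqF // scale1r.
clearbody T q.
have nTn n : norm_le (T ^+ n) (q ^+ n).
  elim: n => [|n IHn]; first by move=> x; rewrite expr0 mul1r.
  by rewrite !exprS; apply: norm_leM.
pose F n : bop H := \sum_(0 <= i < n) T ^+ i.
have TF n : (1 - T) * F n = 1 - T ^+ n.
  elim: n => [|n IHn]; first by rewrite /F big_nil mulr0 expr0 subrr.
  rewrite /F big_nat_recr //= -/(F n) mulrDr IHn mulrBl mul1r -exprS.
  by rewrite addrA subrK.
have FT n : F n * (1 - T) = 1 - T ^+ n.
  elim: n => [|n IHn]; first by rewrite /F big_nil mul0r expr0 subrr.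
  rewrite /F big_nat_recr //= -/(F n) mulrDl IHn mulrBr mulr1 -exprSr.
  by rewrite addrA subrK.
have nF n p : norm_le (F (n + p)%N - F n) (q ^+ n / (1 - q)).
  have q1' : 0 < 1 - q by rewrite subr_gt0.
  have : norm_le (F (n + p)%N - F n) (q ^+ n * (1 - q ^+ p) / (1 - q)).
    elim: p => [|p IHp].
      by rewrite addn0 subrr expr0 subrr mulr0 mul0r => x; rewrite vnorm0 mul0r.
    rewrite addnS /F big_nat_recr //= -/(F _) addrAC.
    have -> : q ^+ n * (1 - q ^+ p.+1) / (1 - q)
      = q ^+ n * (1 - q ^+ p) / (1 - q) + q ^+ (n + p).
      by rewrite exprS exprD; field; rewrite gt_eqF.
    exact: norm_leD.
  apply: norm_le_trans; rewrite ler_pM2r ?invr_gt0 //.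
  by rewrite ler_piMr ?exprn_ge0 // gerBl exprn_ge0.
have q_small e : 0 < e -> exists n, q ^+ n / (1 - q) <= e.
  move=> e0; have q1' : 0 < 1 - q by rewrite subr_gt0.
  have : q ^+ n @[n --> \oo] --> (0 : R).
    by apply: cvg_expr; rewrite ger0_norm.
  move=> /cvgr0_norm_le /(_ (e * (1 - q)) (mulr_gt0 e0 q1')) [n _ /(_ n (leqnn n))].
  by rewrite /= ger0_norm ?exprn_ge0 // => qn; exists n; rewrite ler_pdivrMr.
have [|G FG] := @bop_complete F.
  move=> e e0; have [N qN] := q_small _ (divr_gt0 e0 (ltr0n _ 2)).
  exists N => n p Nn Np.
  have -> : F n - F p = (F n - F N) - (F p - F N) by rewrite opprB addrA subrK.
  rewrite -(subnKC Nn) -(subnKC Np); apply: norm_le_trans (norm_leD (nF _ _)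
    (norm_leN (nF _ _))).
  by move: qN; lra.
have [k k0 Sk] := bop_norm_le (1 - T : bop H).
have small e : 0 < e -> exists n, norm_le (F n - G) e /\ norm_le (T ^+ n) e.
  move=> e0; have [n qn] := q_small _ e0; have [N FN] := FG _ e0.
  exists (n + N)%N; split; first by apply: FN; rewrite leq_addl.
  apply: norm_le_trans (nTn _); apply: le_trans qn.
  have q1' : 0 < 1 - q by rewrite subr_gt0.
  rewrite exprD ler_pdivlMr // (@le_trans _ _ (q ^+ n * q ^+ N)) //.
    by rewrite ler_piMr ?mulr_ge0 ?exprn_ge0 // gerBl.
  by rewrite ler_piMr ?exprn_ge0 // exprn_ile1 // ltW.
have TG : (1 - T) * G = 1.
  apply: (@bop_norm_eq _ _ (k + 1)) => e e0.
  have [n [Fn Tn]] := small e e0.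
  have -> : (1 - T) * G - 1 = - ((1 - T) * (F n - G)) - T ^+ n.
    by rewrite mulrBr TF opprB -addrA -opprD subrK.
  rewrite [(k + 1) * e]mulrDl [1 * e]mul1r; apply: norm_leD; last exact: norm_leN.
  by apply/norm_leN/norm_leM.
have GT : G * (1 - T) = 1.
  apply: (@bop_norm_eq _ _ (k + 1)) => e e0.
  have [n [Fn Tn]] := small e e0.
  have -> : G * (1 - T) - 1 = - ((F n - G) * (1 - T)) - T ^+ n.
    by rewrite mulrBl FT opprB -addrA -opprD subrK.
  rewrite [(k + 1) * e]mulrDl [1 * e]mul1r; apply: norm_leD; last exact: norm_leN.
  by rewrite [k * e]mulrC; apply/norm_leN/norm_leM => //; exact: ltW.
exists ((L^-1)%:C *: G); split.
  by rewrite ST bop_scaleAl bop_scaleAr scalerA -rmorphM mulVf ?gt_eqF // scale1r.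
by rewrite ST bop_scaleAl bop_scaleAr scalerA -rmorphM divff ?gt_eqF // scale1r.
Qed.

End Completeness.

(** * Polynomials of a self-adjoint operator *)

Section PolynomialCalculus.
Variables (R : realType) (H : hilbertType R).
Implicit Types (x y : H) (A B S V : bop H) (p q : {poly R}).

(** Complex coefficients are allowed because positivity of p(A) is proved by splitting polynomials
    into linear factors over [R[i]]. *)
Definition chorner (p : {poly R[i]}) A : bop H :=
  \sum_(i < size p) p`_i *: A ^+ i.

Lemma chorner_wide (p : {poly R[i]}) A n : (size p <= n)%N ->
  chorner p A = \sum_(i < n) p`_i *: A ^+ i.
Proof.
move=> pn; rewrite /chorner (big_ord_widen n (fun i => p`_i *: A ^+ i)) //.
rewrite big_mkcond; apply: eq_bigr => i _; case: ltnP => // /leq_sizeP -> //.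
by rewrite scale0r.
Qed.

Lemma chornerD (p q : {poly R[i]}) A : chorner (p + q) A = chorner p A + chorner q A.
Proof.
have pq := size_polyD p q.
rewrite (chorner_wide A pq) (@chorner_wide p A _ (leq_maxl _ (size q))).
rewrite (@chorner_wide q A _ (leq_maxr (size p) _)) -big_split.
by apply: eq_bigr => i _; rewrite coefD scalerDl.
Qed.

Lemma chornerZ (c : R[i]) (p : {poly R[i]}) A : chorner (c *: p) A = c *: chorner p A.
Proof.
rewrite (chorner_wide A (size_scale_leq c p)) /chorner scaler_sumr.
by apply: eq_bigr => i _; rewrite coefZ scalerA.
Qed.

Lemma chornerMX (p : {poly R[i]}) A : chorner (p * 'X) A = chorner p A * A.
Proof.
have pX : (size (p * 'X)%R <= (size p).+1)%N.
  by rewrite (leq_trans (size_polyMleq _ _)) // size_polyX addn2.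
rewrite (chorner_wide A pX) big_ord_recl coefMX scale0r add0r /chorner mulr_suml.
by apply: eq_bigr => i _; rewrite coefMX /= exprSr bop_scaleAl.
Qed.

Lemma chornerC (c : R[i]) A : chorner c%:P A = c *: (1 : bop H).
Proof.
by rewrite (chorner_wide A (size_polyC_leq1 c)) big_ord1 coefC expr0.
Qed.

Lemma chornerM (p q : {poly R[i]}) A : chorner (p * q) A = chorner p A * chorner q A.
Proof.
elim/poly_ind: q => [|q c IHq]; first by rewrite mulr0 -polyC0 chornerC scale0r mulr0.
rewrite mulrDr mulrA !chornerD !chornerMX IHq chornerC mulrDr mulrA.
by rewrite mulrC mul_polyC chornerZ bop_scaleAr mulr1.
Qed.

Lemma chornerXsubC (c : R[i]) A : chorner ('X - c%:P) A = A - c *: (1 : bop H).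
Proof.
rewrite -polyCN chornerD chornerC -(mul1r 'X) chornerMX -polyC1 chornerC.
by rewrite scale1r mul1r scaleNr.
Qed.

Lemma bop_hornerE p A : bop_horner p A = chorner (map_poly (real_complex R) p) A.
Proof.
rewrite /bop_horner /chorner size_map_poly.
by apply: eq_bigr => i _; rewrite coef_map.
Qed.

Lemma bop_hornerD p q A : bop_horner (p + q) A = bop_horner p A + bop_horner q A.
Proof. by rewrite !bop_hornerE rmorphD chornerD. Qed.

Lemma bop_hornerM p q A : bop_horner (p * q) A = bop_horner p A * bop_horner q A.
Proof. by rewrite !bop_hornerE rmorphM chornerM. Qed.

Lemma bop_hornerC (c : R) A : bop_horner c%:P A = c%:C *: (1 : bop H).
Proof. by rewrite bop_hornerE map_polyC chornerC. Qed.

Lemma bop_hornerZ (c : R) p A : bop_horner (c *: p) A = c%:C *: bop_horner p A.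
Proof. by rewrite -mul_polyC bop_hornerM bop_hornerC bop_scaleAl mul1r. Qed.

Lemma bop_hornerN p A : bop_horner (- p) A = - bop_horner p A.
Proof. by rewrite -scaleN1r bop_hornerZ rmorphN1 scaleN1r. Qed.

Lemma bop_hornerB p q A : bop_horner (p - q) A = bop_horner p A - bop_horner q A.
Proof. by rewrite bop_hornerD bop_hornerN. Qed.

Lemma bop_horner0 A : bop_horner 0 A = 0.
Proof. by rewrite -polyC0 bop_hornerC rmorph0 scale0r. Qed.

Lemma bop_horner1 A : bop_horner 1 A = 1.
Proof. by rewrite -polyC1 bop_hornerC rmorph1 scale1r. Qed.

Lemma bop_hornerX A : bop_horner 'X A = A.
Proof.
by rewrite bop_hornerE map_polyX -(subr0 'X) -polyC0 chornerXsubC scale0r subr0.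
Qed.

Lemma bop_horner_sum I (r : seq I) (P : pred I) (F : I -> {poly R}) A :
  bop_horner (\sum_(i <- r | P i) F i) A = \sum_(i <- r | P i) bop_horner (F i) A.
Proof.
exact: (big_morph (fun p => bop_horner p A) (fun p q => bop_hornerD p q A)
  (bop_horner0 A)).
Qed.

Lemma bop_horner_comm p q A :
  bop_horner p A * bop_horner q A = bop_horner q A * bop_horner p A.
Proof. by rewrite -!bop_hornerM mulrC. Qed.

Lemma self_adjoint_horner p A : self_adjoint A -> self_adjoint (bop_horner p A).
Proof.
move=> sA; elim/poly_ind: p => [|p c IHp].
  by rewrite bop_horner0; exact: self_adjoint0.
rewrite bop_hornerD bop_hornerM bop_hornerX bop_hornerC.
apply: self_adjointD; last exact/self_adjointZ/self_adjoint1.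
by apply: self_adjointM => //; rewrite -{2 3}(bop_hornerX A) bop_horner_comm.
Qed.

(** The inverse bounds |x| by a multiple of |Sx|, and [psd_norm_le] bounds |Sx|^2 by L <Sx,x>. *)
Lemma coercive_of_invertible S V : self_adjoint S ->
  (forall x, 0 <= rip (S x) x) -> is_inverse S V ->
  exists2 d, 0 < d & forall x, d * rip x x <= rip (S x) x.
Proof.
move=> sS S0 [VS _]; have [k k0 Vk] := bop_norm_le V.
have [L0 L00 SL0] := bop_norm_le S.
pose L := L0 + 1; have L_gt0 : 0 < L by rewrite ltr_wpDl.
have SL x : rip (S x) x <= L * rip x x.
  rewrite ripxx (le_trans (rip_cauchy _ _)) // expr2 mulrA ler_wpM2r ?vnorm_ge0 //.
  by rewrite (le_trans (SL0 x)) // ler_wpM2r ?vnorm_ge0 // lerDl.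
pose c := (k + 1) ^+ 2 * L.
have k1 : 0 < k + 1 by rewrite ltr_wpDl.
have c0 : 0 < c by rewrite mulr_gt0 ?exprn_gt0.
exists c^-1 => [|x]; first by rewrite invr_gt0.
rewrite mulrC ler_pdivrMr // ripxx.
have xS : vnorm x <= (k + 1) * vnorm (S x).
  have := Vk (S x); rewrite -bopME VS bop1E => /le_trans; apply.
  by rewrite ler_wpM2r ?vnorm_ge0 // lerDl.
have := psd_norm_le (ltW L_gt0) sS S0 SL x.
move=> /(ler_wpM2l (exprn_ge0 2 (ltW k1))); rewrite -exprMn mulrA => SxL.
rewrite mulrC (le_trans _ SxL) // ler_pXn2r // nnegrE ?vnorm_ge0 //.
by rewrite mulr_ge0 ?vnorm_ge0 // ltW.
Qed.

(* The infimum of the numerical range, if negative, would be a spectral value. *)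
Lemma resolvent_ge0 B : self_adjoint B ->
  (forall r : R, r < 0 -> exists V, is_inverse (B - r%:C *: (1 : bop H)) V) ->
  forall x, 0 <= rip (B x) x.
Proof.
move=> sB Binv x0; rewrite leNgt; apply/negP => Bx0.
pose E : set R := [set r | forall x, r * rip x x <= rip (B x) x].
have [k k0 Bk] := bop_norm_le B.
have x0_gt0 : 0 < rip x0 x0.
  rewrite lt_def ripxx_ge0 andbT; apply/eqP => /rip_eq0 x00.
  by move: Bx0; rewrite x00 rip0r ltxx.
have ubE x r : 0 < rip x x -> E r -> r <= rip (B x) x / rip x x.
  by move=> xx0 /(_ x); rewrite ler_pdivlMr.
have E_sup : has_sup E.
  split; last by exists (rip (B x0) x0 / rip x0 x0) => r; exact: ubE.
  exists (- k) => x; rewrite mulNr -subr_ge0 opprK.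
  have := rip_cauchy (- B x) x; rewrite ripNl vnormN ripxx.
  have := ler_wpM2r (vnorm_ge0 x) (Bk x); rewrite -mulrA -expr2; lra.
have supE : E (sup E).
  move=> x; have [xx0|xx0] := eqVneq (rip x x) 0.
    by rewrite xx0 mulr0 (rip_eq0 xx0) rip0r.
  have xx_gt0 : 0 < rip x x by rewrite lt_def xx0 ripxx_ge0.
  rewrite -ler_pdivlMr //; apply: ge_sup; first by case: E_sup.
  by move=> r; exact: ubE.
have sup_lt0 : sup E < 0.
  apply: le_lt_trans (ubE _ _ x0_gt0 supE) _.
  by rewrite pmulr_llt0 ?invr_gt0.
have [V SV] := Binv _ sup_lt0.
set S := B - _ in SV.
have Sx x : rip (S x) x = rip (B x) x - sup E * rip x x.
  by rewrite /S bopBE ripBl bopZE ripZl.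
have sS : self_adjoint S by exact/self_adjointB/self_adjointZ.
(* [S] is nonnegative because [sup E] belongs to [E]. Being invertible it is even coercive, which
   puts [sup E + d] in [E]. *)
have [|d d0 dS] := coercive_of_invertible sS _ SV.
  by move=> x; rewrite Sx subr_ge0; exact: supE.
have : E (sup E + d).
  by move=> x; have := dS x; rewrite Sx mulrDl; lra.
move=> /(ub_le_sup E_sup.2); lra.
Qed.

(** With [k] a norm bound of [A], [resolvent_ge0] would give A >= k + 1, and then only the zero
    vector is left. This isolates the zero space, the one case where positivity on the spectrum says
    nothing about a constant polynomial. *)
Lemma empty_spectrum A : self_adjoint A -> (forall s, ~ spectrum A s) ->
  forall x : H, x = 0.
Proof.
move=> sA A_inv x; apply: rip_eq0; apply/eqP; rewrite eq_le ripxx_ge0 andbT.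
have [k k0 Ak] := bop_norm_le A.
have : 0 <= rip ((A - (k + 1)%:C *: (1 : bop H)) x) x.
  apply: resolvent_ge0 => [|r r0]; first exact/self_adjointB/self_adjointZ.
  rewrite -addrA -opprD -scalerDl -rmorphD.
  exact: contrapT (A_inv (k + 1 + r)).
have := ler_wpM2r (vnorm_ge0 x) (Ak x); rewrite -mulrA -expr2 -ripxx.
have := rip_cauchy (A x) x.
by rewrite bopBE bopZE ripBl ripZl bop1E; lra.
Qed.

(** [B * V] is a right inverse of [A] and, by commutation, [V * B] is a left inverse; the two must
    agree. *)
Lemma comm_factor_invertible A B V : A * B = B * A -> is_inverse (A * B) V ->
  exists W, is_inverse A W.
Proof.
move=> AB [VAB ABV]; exists (B * V); split; last by rewrite mulrA.
have VBA : V * B * A = 1 by rewrite -mulrA -AB.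
suff -> : B * V = V * B by [].
by rewrite -[B * V]mul1r -VBA -!mulrA (mulrA A B) ABV mulr1.
Qed.

Lemma mul_invertible A B : (exists V, is_inverse A V) ->
  (exists V, is_inverse B V) -> exists V, is_inverse (A * B) V.
Proof.
move=> [V [VA AV]] [W [WB BW]]; exists (W * V).
split; rewrite mulrA.
  by rewrite -(mulrA W) VA mulr1.
by rewrite -(mulrA A) BW mulr1.
Qed.

(** For z = a + ib, the product of A - z and A - conj z is (A - a)^2 + b^2 >= b^2, which is
    coercive; its factors commute, so each is invertible. *)
Lemma nonreal_invertible A (z : R[i]) : self_adjoint A -> complex.Im z != 0 ->
  exists V, is_inverse (A - z *: (1 : bop H)) V.
Proof.
move=> sA z_im; pose a := complex.Re z; pose b := complex.Im z.
pose S := bop_horner (('X - a%:P) ^+ 2 + (b ^+ 2)%:P) A.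
have SE : S = (A - z *: (1 : bop H)) * (A - conjc z *: (1 : bop H)).
  rewrite /S bop_hornerE -!chornerXsubC -chornerM; congr chorner.
  rewrite rmorphD rmorphXn rmorphB /= map_polyX !map_polyC /=.
  have -> : conjc z = a%:C - 'i%C * b%:C.
    by rewrite /a /b; clear; case: z => u v; simpc.
  have -> : z = a%:C + 'i%C * b%:C by exact: complexE.
  rewrite !polyCD polyCN !polyCM rmorphXn polyC_exp.
  have : ('i%C)%:P ^+ 2 = -1 :> {poly R[i]} by rewrite -polyC_exp sqr_i polyCN.
  move: ('i%C%:P) (a%:C%:P) (b%:C%:P) => I a' b' I2.
  have -> : b' ^+ 2 = - (I ^+ 2 * b' ^+ 2) by rewrite I2 mulN1r opprK.
  by ring.
have sS : self_adjoint S by exact: self_adjoint_horner.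
have [||V SV] := @coercive_invertible _ _ S (b ^+ 2) sS.
- by rewrite exprn_even_gt0.
- move=> x; rewrite /S bop_hornerD bop_hornerC bopDE ripDl bopZE ripZl lerDr.
  rewrite expr2 bop_hornerM bopME.
  have /self_adjointP -> := @self_adjoint_horner ('X - a%:P) A sA.
  exact: ripxx_ge0.
rewrite SE in SV; apply: comm_factor_invertible SV.
by rewrite -!chornerXsubC -!chornerM mulrC.
Qed.

(* p(A) - r with r < 0 is a product of factors A - z with p(z) = r. *)
Lemma horner_ge0 p A : self_adjoint A ->
  (forall s, spectrum A s -> 0 <= p.[s]) ->
  forall x, 0 <= rip (bop_horner p A x) x.
Proof.
move=> sA p0; apply: resolvent_ge0 => [|r r0]; first exact: self_adjoint_horner.
rewrite -(bop_hornerC r A) -bop_hornerB bop_hornerE; set q := map_poly _ _.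
have [rs q_rs] := closed_field_poly_normal q.
(* A zero leading coefficient means that [p] is the negative constant [r]. The hypothesis then
   leaves no spectral value, so the space is zero and [0] is an inverse. *)
have [lc0|lc_neq0] := eqVneq (lead_coef q) 0.
  have p_r : p = r%:P.
    apply/eqP; rewrite -subr_eq0 -(map_poly_eq0 (real_complex R)).
    by rewrite -lead_coef_eq0 lc0.
  have H0 : forall x : H, x = 0.
    apply: empty_spectrum sA _ => s /p0; rewrite p_r hornerC.
    by rewrite leNgt r0.
  by exists 0; split; apply: bop_ext => x; rewrite [LHS]H0 [RHS]H0.
have rs_root z : z \in rs -> root q z.
  by move=> z_rs; rewrite q_rs rootZ // root_prod_XsubC.
rewrite q_rs chornerZ.
have : exists V, is_inverse (chorner (\prod_(z <- rs) ('X - z%:P)) A) V.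
  elim: rs rs_root {q_rs} => [_|z rs IHrs rs_root].
    by exists 1; rewrite big_nil -polyC1 chornerC scale1r; split; rewrite mulr1.
  rewrite big_cons chornerM; apply: mul_invertible; last first.
    by apply: IHrs => w w_rs; rewrite rs_root // inE w_rs orbT.
  rewrite chornerXsubC; have [z_re|] := eqVneq (complex.Im z) 0; last first.
    exact: nonreal_invertible.
  have zE : z = (complex.Re z)%:C by rewrite [LHS]complexE z_re mulr0 addr0.
  (* A real root [z] satisfies p(z) = r < 0, so it is not a spectral value. *)
  rewrite zE; apply: contrapT => /p0; apply/negP; rewrite -ltNge.
  have := rs_root z (mem_head _ _); rewrite zE /root horner_map.
  by rewrite fmorph_eq0 hornerD hornerN hornerC subr_eq0 => /eqP ->.
move=> [V [VS SV]]; exists ((lead_coef q)^-1 *: V).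
by split; rewrite bop_scaleAl bop_scaleAr scalerA ?VS ?SV ?mulVf ?divff ?scale1r.
Qed.

Lemma spectrum_bounds A (a b : R) s : self_adjoint A ->
  (forall x, a * rip x x <= rip (A x) x) ->
  (forall x, rip (A x) x <= b * rip x x) -> spectrum A s -> a <= s <= b.
Proof.
move=> sA aA Ab As; have sS : self_adjoint (A - s%:C *: (1 : bop H)).
  exact/self_adjointB/self_adjointZ.
apply/andP; split; rewrite leNgt; apply/negP => sab; apply: As.
  apply: (coercive_invertible sS (d := a - s)) => [|x]; first by rewrite subr_gt0.
  by have := aA x; rewrite bopBE bopZE ripBl ripZl bop1E; lra.
have [||V [VS SV]] := coercive_invertible (self_adjointN sS) (d := s - b).
- by rewrite subr_gt0.
- by move=> x; have := Ab x; rewrite bopNE bopBE bopZE ripNl ripBl ripZl bop1E; lra.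
by exists (- V); split; [rewrite mulNr -mulrN | rewrite mulrN -mulNr].
Qed.

End PolynomialCalculus.

(** * Functional calculus *)

Section FunctionalCalculus.
Variables (R : realType) (H : hilbertType R).
Implicit Types (x y : H) (A B F G P : bop H) (p q : {poly R}) (f g : R -> R).

Lemma rip_norm_le A k x : norm_le A k -> `|rip (A x) x| <= k * rip x x.
Proof.
move=> Ak; have := ler_wpM2r (vnorm_ge0 x) (Ak x).
rewrite -mulrA -expr2 -ripxx => kx; rewrite ler_norml.
have := rip_cauchy (A x) x; have := rip_cauchy (- A x) x.
by rewrite vnormN ripNl; lra.
Qed.

Lemma rip2_norm_le A k x y : norm_le A k -> `|rip (A x) y| <= k * (vnorm x * vnorm y).
Proof.
move=> Ak; have := ler_wpM2r (vnorm_ge0 y) (Ak x); rewrite -mulrA ler_norml.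
have := rip_cauchy (A x) y; have := rip_cauchy (- A x) y.
by rewrite vnormN ripNl; lra.
Qed.

Lemma self_adjoint_limit F :
  (forall e : R, 0 < e -> exists2 P, self_adjoint P & norm_le (P - F) e) ->
  self_adjoint F.
Proof.
move=> F_lim; apply/self_adjointP => x y; apply/eqP; rewrite -subr_eq0 -normr_le0.
apply/ler_addgt0Pr => e e0; rewrite add0r.
pose c := 2 * (vnorm x * vnorm y) + 1.
have c0 : 0 < c by rewrite ltr_wpDl ?mulr_ge0 ?vnorm_ge0.
have [P /self_adjointP sP PF] := F_lim _ (divr_gt0 e0 c0).
have := rip2_norm_le x y PF; have := rip2_norm_le y x PF.
have : e / c * c = e by rewrite divfK // gt_eqF.
have := divr_gt0 e0 c0; rewrite /c.
rewrite !bopBE !ripBl !ler_norml (ripC (P y)) (ripC (F y)) sP (mulrC (vnorm y)).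
by move=> h1 h2 /andP[h3 h4] /andP[h5 h6]; lra.
Qed.

Lemma self_adjoint_eq0 A : self_adjoint A -> (forall x, rip (A x) x = 0) -> A = 0.
Proof.
move=> sA A0; apply: bop_ext => x; apply: rip_eq0.
have A_ge0 y : 0 <= rip (A y) y by rewrite A0.
have := psd_cauchy x (A x) sA A_ge0.
by rewrite A0 mul0r => h; apply/eqP; rewrite -sqrf_eq0 eq_le h sqr_ge0.
Qed.

(** Since e^2 - p^2 is nonnegative on the spectrum, |p(A)x|^2 = <p(A)^2 x, x> <= e^2 |x|^2. Uniform
    convergence on the spectrum thus becomes norm convergence. *)
Lemma horner_norm_le p A e : self_adjoint A -> 0 <= e ->
  (forall s, spectrum A s -> `|p.[s]| <= e) -> norm_le (bop_horner p A) e.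
Proof.
move=> sA e0 pe x; rewrite -(ler_pXn2r (ltn0Sn 1)) ?nnegrE ?vnorm_ge0 //; last first.
  by rewrite mulr_ge0 ?vnorm_ge0.
have := @horner_ge0 _ _ ((e ^+ 2)%:P - p * p) A sA.
rewrite bop_hornerB bop_hornerM bop_hornerC => /(_ _ x).
rewrite bopBE bopZE bop1E bopME ripBl ripZl.
have /self_adjointP -> := self_adjoint_horner p sA.
rewrite exprMn -!ripxx subr_ge0; apply=> s /pe.
rewrite hornerD hornerN hornerM hornerC subr_ge0 -expr2.
by rewrite -real_normK ?num_real // ler_pXn2r ?nnegrE.
Qed.

(* A weakening of is_funcalc that is all the calculus needs. *)
Definition fcalc f A F := forall e : R, 0 < e -> exists2 p : {poly R},
  (forall s, spectrum A s -> `|p.[s] - f s| <= e) & norm_le (bop_horner p A - F) e.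

Lemma fcalc_self_adjoint f A F : self_adjoint A -> fcalc f A F -> self_adjoint F.
Proof.
move=> sA fF; apply: self_adjoint_limit => e /fF[p _ pF].
by exists (bop_horner p A) => //; exact: self_adjoint_horner.
Qed.

Lemma fcalc_is_funcalc f A F : is_funcalc f A F -> fcalc f A F.
Proof.
move=> [p [pf pF]] e e0.
have [N _ fN] := pf e e0; have [N' _ FN'] := pF e e0.
exists (p (maxn N N')) => [s As|].
  by apply: fN => //; exact: leq_maxl.
by apply/norm_leP => x; apply: FN'; exact: leq_maxr.
Qed.

(** [funcalc] has the default value 0. Approximability on the spectrum excludes that default case:
    by [horner_norm_le] the operators p_n(A) are Cauchy, so a limit exists for [xget] to pick. *)
Lemma funcalcP f A : self_adjoint A ->
  (forall e : R, 0 < e -> exists p : {poly R},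
     forall s, spectrum A s -> `|p.[s] - f s| <= e) ->
  fcalc f A (funcalc f A).
Proof.
move=> sA f_approx; apply: fcalc_is_funcalc; rewrite /funcalc; case: xgetP => [F -> //|].
have e_gt0 n : 0 < n.+1%:R^-1 :> R by rewrite invr_gt0.
have [p pf] := choice (fun n => f_approx _ (e_gt0 n)).
have small e : 0 < e -> exists N, forall n, (N <= n)%N -> n.+1%:R^-1 <= e :> R.
  move=> e0; exists (Num.truncn e^-1) => n Nn.
  rewrite -[leRHS]invrK lef_pV2 ?posrE ?invr_gt0 //.
  by rewrite (le_trans (ltW (truncnS_gt _))) // ler_nat.
have [|F pF] := @bop_complete _ _ (fun n => bop_horner (p n) A).
  move=> e e0; have [N eN] := small _ (divr_gt0 e0 (ltr0n _ 2)).
  exists N => n k Nn Nk; rewrite -bop_hornerB; apply: horner_norm_le => // [|s As].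
    exact: ltW.
  have := pf n s As; have := pf k s As; have := eN n Nn; have := eN k Nk.
  rewrite hornerD hornerN !ler_norml => h1 h2 /andP[h3 h4] /andP[h5 h6].
  move: h1 h2 h3 h4 h5 h6; move: (k.+1%:R^-1) (n.+1%:R^-1) => c d *.
  by apply/andP; split; lra.
move=> /(_ F)[]; exists p; split=> e e0.
  have [N eN] := small e e0; exists N => // n Nn s As.
  exact: le_trans (pf n s As) (eN n Nn).
by have [N FN] := pF e e0; exists N => // n Nn; apply/norm_leP/FN.
Qed.

Lemma fcalc_horner p A : fcalc (fun s => p.[s]) A (bop_horner p A).
Proof.
move=> e e0; exists p => [s _|x]; first by rewrite subrr normr0 ltW.
by rewrite subrr vnorm0 mulr_ge0 ?vnorm_ge0 // ltW.
Qed.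

Lemma fcalc_le f g A F G : self_adjoint A -> fcalc f A F -> fcalc g A G ->
  (forall s, spectrum A s -> f s <= g s) -> forall x, rip (F x) x <= rip (G x) x.
Proof.
move=> sA fF gG fg x; apply/ler_addgt0Pr => e e0.
(* Four errors [d]: one for each operator approximation, and the shift [2 * d] that makes
   [q + 2d - p] nonnegative on the spectrum. *)
pose c := 4 * rip x x + 1.
have c0 : 0 < c by rewrite ltr_wpDl ?mulr_ge0 ?ripxx_ge0.
have d0 := divr_gt0 e0 c0.
have : e / c * c = e by rewrite divfK // gt_eqF.
rewrite /c; move: d0; move: (e / _) => d d0.
have [p pf /(@rip_norm_le _ _ x)] := fF _ d0.
have [q qg /(@rip_norm_le _ _ x)] := gG _ d0.
have := @horner_ge0 _ _ (q + (2 * d)%:P - p) A sA.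
rewrite bop_hornerB bop_hornerD bop_hornerC => /(_ _ x).
rewrite !(bopDE, bopNE, bopZE, bop1E) !(ripDl, ripNl, ripZl) => pq.
rewrite !ler_norml => /andP[h1 h2] /andP[h3 h4] h5.
have /pq : forall s, spectrum A s -> 0 <= (q + (2 * d)%:P - p).[s].
  move=> s As; have := fg s As; have := pf s As; have := qg s As.
  rewrite !hornerE !ler_norml => /andP[h6 h7] /andP[h8 h9]. lra.
by lra.
Qed.

(** The case [f = g] is uniqueness of the calculus. This lemma reduces operator identities to scalar
    identities on the spectrum. *)
Lemma fcalc_eq f g A F G : self_adjoint A -> fcalc f A F -> fcalc g A G ->
  (forall s, spectrum A s -> f s = g s) -> F = G.
Proof.
move=> sA fF gG fg; apply/eqP; rewrite -subr_eq0; apply/eqP/self_adjoint_eq0.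
  by apply: self_adjointB; [exact: fcalc_self_adjoint fF|exact: fcalc_self_adjoint gG].
move=> x; rewrite bopBE ripBl; apply/eqP; rewrite subr_eq0 eq_le.
rewrite (fcalc_le sA fF gG) ?(fcalc_le sA gG fF) // => s As; rewrite fg //.
Qed.

Lemma fcalcM f g A F G C : fcalc f A F -> fcalc g A G ->
  (forall s, spectrum A s -> `|f s| <= C /\ `|g s| <= C) ->
  fcalc (fun s => f s * g s) A (F * G).
Proof.
move=> fF gG fgC e e0.
have [k k0 Fk] := bop_norm_le F; have [l l0 Gl] := bop_norm_le G.
pose c := 2 * (`|C| + k + l) + 2.
have c0 : 0 < c by rewrite ltr_wpDl // mulr_ge0 // !addr_ge0.
(* [d <= 1] absorbs the quadratic error [d * d], and [c] dominates the coefficients of the linear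
   errors for both the scalars and the operators. *)
pose d := Num.min 1 (e / c).
have d0 : 0 < d by rewrite lt_min ltr01 divr_gt0.
have d1 : d <= 1 by rewrite ge_min lexx.
have dc : d * c <= e by rewrite -ler_pdivlMr // ge_min lexx orbT.
have [p pf pF] := fF d d0; have [q qg qG] := gG d d0.
exists (p * q) => [s As|].
  have [fC gC] := fgC s As; have := pf s As; have := qg s As; rewrite hornerM.
  have -> : p.[s] * q.[s] - f s * g s = (p.[s] - f s) * (q.[s] - g s)
    + f s * (q.[s] - g s) + (p.[s] - f s) * g s by ring.
  move=> h1 h2; apply: le_trans (ler_normD _ _) _.
  have := ler_normD ((p.[s] - f s) * (q.[s] - g s)) (f s * (q.[s] - g s)).
  rewrite !normrM => /le_trans h3.
  have C1 := le_trans fC (ler_norm C); have C2 := le_trans gC (ler_norm C).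
  have h4 : `|p.[s] - f s| * `|q.[s] - g s| <= d * 1.
    by rewrite ler_pM // (le_trans h1).
  have h5 : `|f s| * `|q.[s] - g s| <= `|C| * d by rewrite ler_pM.
  have h6 : `|p.[s] - f s| * `|g s| <= d * `|C| by rewrite ler_pM.
  have h7 : 0 <= d * (k + l) by rewrite mulr_ge0 ?addr_ge0 // ltW.
  have := h3 _ (lerD h4 h5); move: dc; rewrite /c; lra.
rewrite bop_hornerM.
have -> : bop_horner p A * bop_horner q A - F * G
   = (bop_horner p A - F) * (bop_horner q A - G)
     + F * (bop_horner q A - G) + (bop_horner p A - F) * G.
  by rewrite -mulrDl subrK mulrBr mulrBl addrA subrK.
apply: (@norm_le_trans _ _ _ (d * d + k * d + d * l)).
  have : d * d <= d * 1 by rewrite ler_pM2l.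
  have : 0 <= d * (`|C| + k + l) by rewrite mulr_ge0 ?addr_ge0 // ltW.
  have : 0 <= d * `|C| by rewrite mulr_ge0 // ltW.
  have : 0 <= d * k by rewrite mulr_ge0 // ltW.
  have : 0 <= d * l by rewrite mulr_ge0 // ltW.
  by move: dc; rewrite /c; lra.
have d0' := ltW d0.
by apply: norm_leD; [apply: norm_leD|]; apply: norm_leM.
Qed.

End FunctionalCalculus.

(** * Bernstein approximation of real powers *)

Section BernsteinPolynomials.
Variable R : realType.
Implicit Types (a c u w x : R) (n k : nat).

(** The basis is kept as polynomials on [a, a + w], so that it can also be evaluated at an
    operator. *)
Definition bernstein a w n k : {poly R} :=
  'C(n, k)%:R *: ((w^-1 *: ('X - a%:P)) ^+ k
                  * (1 - w^-1 *: ('X - a%:P)) ^+ (n - k)).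

Definition bernstein_node a w n k : R := a + w * (k%:R / n%:R).

Definition binom_weight u n k : R := 'C(n, k)%:R * (u ^+ k * (1 - u) ^+ (n - k)).

Lemma horner_bernstein a w n k x :
  (bernstein a w n k).[x] = binom_weight ((x - a) / w) n k.
Proof. by rewrite /bernstein /binom_weight !(hornerE, horner_exp) /= (mulrC w^-1). Qed.

(* Generating function: its derivatives at 1 give the moments. *)
Lemma binom_weight_poly u n :
  ((1 - u)%:P + u *: 'X) ^+ n = \sum_(k < n.+1) binom_weight u n k *: 'X^k.
Proof.
rewrite exprDn; apply: eq_bigr => k _.
rewrite exprZn -polyC_exp mul_polyC scalerA -scaler_nat scalerA.
by rewrite /binom_weight (mulrC (u ^+ k)).
Qed.

Lemma sum_binom_weight u n : \sum_(k < n.+1) binom_weight u n k = 1.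
Proof.
have := congr1 (horner^~ 1) (binom_weight_poly u n).
rewrite !(hornerE, horner_exp) /= ?mulr1 subrK expr1n horner_sum => ->.
by apply: eq_bigr => k _; rewrite !hornerE expr1n mulr1.
Qed.

Lemma binom_weight_mean u n :
  \sum_(k < n.+1) binom_weight u n k * k%:R = n%:R * u.
Proof.
have := congr1 (fun p : {poly R} => p^`().[1]) (binom_weight_poly u n).
rewrite deriv_exp derivD derivC derivZ derivX add0r raddf_sum /= horner_sum.
rewrite !(hornerE, horner_exp, hornerMn) /= ?mulr1 subrK expr1n ?mulr1.
rewrite -mulr_natl => ->; apply: eq_bigr => k _.
by rewrite derivZ derivXn !(hornerE, hornerMn) expr1n.
Qed.

Lemma binom_weight_moment2 u n :
  \sum_(k < n.+1) binom_weight u n k * (k * k.-1)%:R = (n * n.-1)%:R * u ^+ 2.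
Proof.
have := congr1 (fun p : {poly R} => p^`()^`().[1]) (binom_weight_poly u n).
rewrite deriv_exp derivD derivC derivZ derivX add0r derivMn derivM derivZ derivC.
rewrite scaler0 mul0r add0r deriv_exp derivD derivC derivZ derivX add0r.
rewrite !raddf_sum /= horner_sum.
rewrite !(hornerE, horner_exp, hornerMn) /= ?mulr1 subrK expr1n ?mulr1.
move=> h; transitivity (\sum_(k < n.+1) (binom_weight u n k *: 'X^k)^`()^`().[1]).
  apply: eq_bigr => k _.
  by rewrite derivZ derivXn derivZ derivMn derivXn !(hornerE, hornerMn) expr1n
    natrM -mulrnA natrM (mulrC k%:R).
by rewrite -h natrM -[_ *+ n]mulr_natr -[u *+ _]mulr_natr; ring.
Qed.

Lemma binom_weight_variance u n :
  \sum_(k < n.+1) binom_weight u n k * (k%:R - n%:R * u) ^+ 2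
  = n%:R * (u * (1 - u)).
Proof.
transitivity (\sum_(k < n.+1) (binom_weight u n k * (k * k.-1)%:R
   + (1 - 2 * (n%:R * u)) * (binom_weight u n k * k%:R)
   + (n%:R * u) ^+ 2 * binom_weight u n k)).
  apply: eq_bigr => -[[|k] _] _ /=; first by ring.
  by rewrite natrM -(@natr1 _ k); ring.
rewrite !big_split /= -!mulr_sumr binom_weight_moment2 binom_weight_mean.
rewrite sum_binom_weight; case: n => [|n] /=; first by ring.
by rewrite natrM -(@natr1 _ n); ring.
Qed.

Variables (a w : R).
Hypothesis w_gt0 : 0 < w.

Lemma bernstein_ge0 n k x : a <= x <= a + w -> 0 <= (bernstein a w n k).[x].
Proof.
move=> /andP[ax xw]; rewrite horner_bernstein /binom_weight mulr_ge0 // mulr_ge0 //.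
  by rewrite exprn_ge0 // divr_ge0 ?subr_ge0 // ltW.
by rewrite exprn_ge0 // subr_ge0 ler_pdivrMr // mul1r lerBlDl.
Qed.

Lemma bernstein_node_ge n k : a <= bernstein_node a w n k.
Proof. by rewrite lerDl mulr_ge0 ?(ltW w_gt0) // divr_ge0. Qed.

Lemma sum_bernstein n : \sum_(k < n.+1) bernstein a w n k = 1.
Proof.
rewrite /bernstein; set U := w^-1 *: _.
rewrite -[RHS](expr1n _ n) -[in RHS](subrK U 1) exprDn.
by apply: eq_bigr => k _; rewrite scaler_nat mulrC.
Qed.

(** Bernstein operators reproduce the identity function. The degree is [n.+1] because the nodes
    divide by it. *)
Lemma bernstein_mean n x :
  \sum_(k < n.+2) (bernstein a w n.+1 k).[x] * bernstein_node a w n.+1 k = x.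
Proof.
transitivity (\sum_(k < n.+2) (a * binom_weight ((x - a) / w) n.+1 k
    + w / n.+1%:R * (binom_weight ((x - a) / w) n.+1 k * k%:R))).
  by apply: eq_bigr => k _; rewrite horner_bernstein /bernstein_node; ring.
rewrite big_split /= -!mulr_sumr sum_binom_weight binom_weight_mean.
by field; rewrite gt_eqF //= addrC natr1 pnatr_eq0.
Qed.

Lemma bernstein_variance n x : a <= x <= a + w ->
  \sum_(k < n.+2) (bernstein a w n.+1 k).[x] * (bernstein_node a w n.+1 k - x) ^+ 2
  <= w ^+ 2 / n.+1%:R.
Proof.
move=> /andP[ax xw]; set u := (x - a) / w.
have u0 : 0 <= u by rewrite divr_ge0 ?subr_ge0 // ltW.
have u1 : u <= 1 by rewrite ler_pdivrMr // mul1r lerBlDl.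
have xE : x = a + w * u by rewrite /u; field; rewrite gt_eqF.
have n0 : n.+1%:R != 0 :> R by rewrite pnatr_eq0.
rewrite (eq_bigr (fun k : 'I__ => (w / n.+1%:R) ^+ 2
    * (binom_weight u n.+1 k * (k%:R - n.+1%:R * u) ^+ 2))); last first.
  by move=> k _; rewrite horner_bernstein /bernstein_node -/u xE; field.
rewrite -mulr_sumr binom_weight_variance.
have -> : (w / n.+1%:R) ^+ 2 * (n.+1%:R * (u * (1 - u)))
  = w ^+ 2 / n.+1%:R * (u * (1 - u)) by field.
rewrite ler_piMr ?divr_ge0 ?sqr_ge0 //; nra.
Qed.

End BernsteinPolynomials.

Section RealPowers.
Variable R : realType.
Implicit Types (a b r x y : R).

(** Concavity of s^r in the form of its tangent at [x], that is, weighted AM-GM. *)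
Lemma powR_tangent r x y : 0 <= r -> r <= 1 -> 0 < x -> 0 < y ->
  y `^ r <= x `^ r * (1 - r + r * (y / x)).
Proof.
move=> r0 r1 x0 y0.
pose z := ln (y / x); have zE : y / x = expR z by rewrite lnK // posrE divr_gt0.
have yx : (y / x) `^ r = expR (r * z) by rewrite /powR gt_eqF ?divr_gt0.
rewrite -[y in y `^ r](divfK (lt0r_neq0 x0)) powRM ?(ltW x0) ?(ltW (divr_gt0 y0 x0)) //.
rewrite yx (mulrC (expR _)).
rewrite ler_pM2l ?powR_gt0 // zE.
(* The bounds exp(-rz) >= 1 - rz and exp((1-r)z) >= 1 + (1-r)z, weighted by 1 - r and r, have
   cancelling linear terms. *)
have := expR_ge1Dx ((1 - r) * z); have := expR_ge1Dx (- (r * z)).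
have := expRxMexpNx_1 (r * z).
have -> : expR z = expR (r * z) * expR ((1 - r) * z) by rewrite -expRD; congr expR; ring.
have := expR_gt0 (r * z); set e := expR (r * z).
set f := expR (- _); set g := expR ((1 - r) * z) => e0 ef hf hg.
have h1 : (1 - r) * (e * (1 - r * z)) <= (1 - r) * 1.
  by rewrite ler_wpM2l ?subr_ge0 // -[leRHS]ef ler_pM2l.
have h2 : r * (e * (1 + (1 - r) * z)) <= r * (e * g).
  by rewrite ler_wpM2l // ler_pM2l.
lra.
Qed.

(** The tangent at [u] has slope r u^(r-1), which is at most a^(r-1) for u >= a. *)
Lemma powR_lipschitz r a x y : 0 < a -> 0 <= r -> r <= 1 -> a <= x -> a <= y ->
  `|y `^ r - x `^ r| <= a `^ (r - 1) * `|y - x|.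
Proof.
move=> a0 r0 r1.
have half u v : a <= u -> a <= v -> v `^ r - u `^ r <= a `^ (r - 1) * `|v - u|.
  move=> au av; have u0 := lt_le_trans a0 au; have v0 := lt_le_trans a0 av.
  have := powR_tangent r0 r1 u0 v0.
  have -> : u `^ r * (1 - r + r * (v / u)) = u `^ r + r * (u `^ (r - 1) * (v - u)).
    rewrite powRB ?(gt_eqF u0) ?implybT // powRr1 ?(ltW u0) //.
    by field; rewrite gt_eqF.
  have h1 : u `^ (r - 1) <= a `^ (r - 1).
    rewrite -opprB !powRN lef_pV2 ?posrE ?powR_gt0 //.
    by rewrite ge0_ler_powR ?nnegrE ?subr_ge0 // ltW.
  have h2 : r * (u `^ (r - 1) * (v - u)) <= r * (u `^ (r - 1) * `|v - u|).
    by rewrite !ler_wpM2l ?powR_ge0 ?ler_norm.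
  have h3 : r * (u `^ (r - 1) * `|v - u|) <= u `^ (r - 1) * `|v - u|.
    by rewrite ler_piMl // mulr_ge0 ?powR_ge0.
  have h4 : u `^ (r - 1) * `|v - u| <= a `^ (r - 1) * `|v - u|.
    by rewrite ler_wpM2r.
  lra.
move=> ax ay; have := half x y ax ay; have := half y x ay ax.
by rewrite (distrC x y) ler_norml => h1 h2; apply/andP; split; lra.
Qed.

(* Bernstein's proof of the Weierstrass theorem, for Lipschitz functions. *)
Lemma lipschitz_poly_approx (f : R -> R) a w (L e : R) : 0 < w -> 0 <= L -> 0 < e ->
  (forall x y, a <= x <= a + w -> a <= y <= a + w -> `|f y - f x| <= L * `|y - x|) ->
  exists p : {poly R}, forall x, a <= x <= a + w -> `|p.[x] - f x| <= e.
Proof.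
move=> w0 L0 e0 fL.
have L1 : 0 < 2 * (L + 1) by rewrite mulr_gt0 // ltr_wpDl.
(* The final error is L d + (L / d) d^2 = 2 L d; [n] is then taken so large that the variance is at
   most d^2. *)
have [d d0 dL] : exists2 d, 0 < d & d * (2 * (L + 1)) = e.
  by exists (e / (2 * (L + 1))); [exact: divr_gt0|rewrite divfK // gt_eqF].
pose n := Num.truncn (w ^+ 2 / d ^+ 2).
have nd : w ^+ 2 / n.+1%:R <= d ^+ 2.
  rewrite ler_pdivrMr ?ltr0Sn // mulrC -ler_pdivrMr ?exprn_gt0 //.
  by rewrite ltW // truncnS_gt.
exists (\sum_(k < n.+2) f (bernstein_node a w n.+1 k) *: bernstein a w n.+1 k).
move=> x axw; rewrite horner_sum.
have -> : f x = \sum_(k < n.+2) f x * (bernstein a w n.+1 k).[x].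
  by rewrite -mulr_sumr -horner_sum sum_bernstein hornerE ?mulr1.
rewrite -sumrB; apply: le_trans (ler_norm_sum _ _ _) _.
apply: (@le_trans _ _ (\sum_(k < n.+2) (L * d * (bernstein a w n.+1 k).[x] + L / d *
   ((bernstein a w n.+1 k).[x] * (bernstein_node a w n.+1 k - x) ^+ 2)))).
  apply: ler_sum => k _; rewrite hornerZ -mulrBl normrM.
  have b0 := bernstein_ge0 w0 n.+1 k axw; rewrite (ger0_norm b0).
  have xk : a <= bernstein_node a w n.+1 k <= a + w.
    rewrite bernstein_node_ge //= lerD2l ler_piMr ?(ltW w0) //.
    by rewrite ler_pdivrMr ?ltr0Sn // mul1r ler_nat -ltnS.
  have := fL _ _ axw xk; set z := bernstein_node _ _ _ _ - x => /(ler_wpM2r b0).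
  move=> /le_trans; apply; set B := _.[x].
  (* This inequality takes the place of splitting the sum into nodes near [x] and far from it. *)
  have zd : `|z| <= d + z ^+ 2 / d.
    rewrite -real_normK ?num_real // -(ler_pM2r d0) mulrDl divfK ?gt_eqF //.
    have := normr_ge0 z; have := sqr_ge0 (`|z| - d); nra.
  rewrite -subr_ge0; have := ler_wpM2l (mulr_ge0 L0 b0) zd; rewrite -/B.
  lra.
rewrite big_split /= -!mulr_sumr -horner_sum sum_bernstein hornerC mulr1.
have := bernstein_variance w0 n axw => /le_trans/(_ nd).
have Ld : 0 <= L / d by rewrite divr_ge0 // ltW.
move=> /(ler_wpM2l Ld).
have -> : L / d * d ^+ 2 = L * d by field; rewrite gt_eqF.
by move: d0 dL; lra.
Qed.

(** Negative exponents occur in the geometric mean. They are handled as reciprocals of s^|r|, which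
    stays above a^|r|. *)
Lemma powR_poly_approx r a b e : 0 < a -> `|r| <= 1 -> 0 < e ->
  exists p : {poly R}, forall x, a <= x <= b -> `|p.[x] - x `^ r| <= e.
Proof.
move=> a0 r1 e0; have [ba|ab] := ltP b a.
  by exists 0 => x /andP[ax xb]; have := lt_le_trans ba ax; rewrite ltNge xb.
have w0 : 0 < b - a + 1 by rewrite ltr_wpDl // subr_ge0.
pose s := `|r|; have s0 : 0 <= s by exact: normr_ge0.
suff [L L0 fL] : exists2 L, 0 <= L & forall x y, a <= x -> a <= y ->
    `|y `^ r - x `^ r| <= L * `|y - x|.
  have [p pf] : exists p : {poly R}, forall x, a <= x <= a + (b - a + 1) ->
      `|p.[x] - x `^ r| <= e.
    apply: lipschitz_poly_approx w0 L0 e0 _ => x y /andP[ax _] /andP[ay _].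
    exact: fL.
  by exists p => x /andP[ax xb]; apply: pf; rewrite ax /=; lra.
have [r0|r0] := leP 0 r.
  exists (a `^ (r - 1)) => [|x y ax ay]; first exact: powR_ge0.
  by apply: powR_lipschitz => //; rewrite -(ger0_norm r0).
have rs : r = - s by rewrite /s ltr0_norm // opprK.
exists (a `^ (s - 1) / (a `^ s * a `^ s)) => [|x y ax ay].
  by rewrite divr_ge0 ?mulr_ge0 ?powR_ge0.
have x0 := lt_le_trans a0 ax; have y0 := lt_le_trans a0 ay.
have xs := powR_gt0 s x0; have ys := powR_gt0 s y0; have as0 := powR_gt0 s a0.
rewrite rs !powRN.
have -> : (y `^ s)^-1 - (x `^ s)^-1 = (x `^ s - y `^ s) / (x `^ s * y `^ s).
  by field; rewrite !gt_eqF.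
rewrite normrM normfV (ger0_norm (_ : 0 <= x `^ s * y `^ s)) ?mulr_ge0 ?powR_ge0 //.
rewrite mulrAC ler_pM ?invr_ge0 ?mulr_ge0 ?powR_ge0 //.
  by rewrite distrC powR_lipschitz.
rewrite lef_pV2 ?posrE ?mulr_gt0 // ler_pM ?powR_ge0 //.
  by rewrite ge0_ler_powR ?nnegrE // ltW.
by rewrite ge0_ler_powR ?nnegrE // ltW.
Qed.

End RealPowers.

(** * Powers and geometric means of operators *)

Section Powers.
Variables (R : realType) (H : hilbertType R).
Implicit Types (x y : H) (A B F V X Z : bop H) (a b r : R).

Definition between a b A := [/\ self_adjoint A,
  forall x, a * rip x x <= rip (A x) x & forall x, rip (A x) x <= b * rip x x].

Lemma between_sa a b A : between a b A -> self_adjoint A. Proof. by case. Qed.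

Lemma between_spectrum a b A s : between a b A -> spectrum A s -> a <= s <= b.
Proof. by case=> sA aA Ab; exact: spectrum_bounds. Qed.

Lemma between_ge0 a b A : 0 <= a -> between a b A -> forall x, 0 <= rip (A x) x.
Proof. by move=> a0 [_ aA _] x; rewrite (le_trans _ (aA x)) // mulr_ge0 ?ripxx_ge0. Qed.

Lemma horner_between_ge0 (p : {poly R}) a b A : between a b A ->
  (forall s, a <= s <= b -> 0 <= p.[s]) -> forall x, 0 <= rip (bop_horner p A x) x.
Proof.
move=> Aab p0 x; apply: horner_ge0; first exact: between_sa Aab.
by move=> s /(between_spectrum Aab)/p0.
Qed.

Lemma fcalc_between f a b c d A F : between a b A -> fcalc f A F ->
  (forall s, a <= s <= b -> c <= f s <= d) -> between c d F.
Proof.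
move=> Aab fF fcd; have sA := between_sa Aab.
have fs s : spectrum A s -> c <= f s <= d by move=> /(between_spectrum Aab)/fcd.
split=> [|x|x]; first exact: fcalc_self_adjoint fF.
  have -> : c * rip x x = rip (bop_horner c%:P A x) x.
    by rewrite bop_hornerC bopZE ripZl.
  apply: fcalc_le (fcalc_horner _ _) fF _ x => // s /fs /andP[cs _].
  by rewrite hornerC.
have -> : d * rip x x = rip (bop_horner d%:P A x) x.
  by rewrite bop_hornerC bopZE ripZl.
apply: fcalc_le fF (fcalc_horner _ _) _ x => // s /fs /andP[_ sd].
by rewrite hornerC.
Qed.

Lemma bop_powP r a b A : 0 < a -> `|r| <= 1 -> between a b A ->
  fcalc (fun s => s `^ r) A (bop_pow A r).
Proof.
move=> a0 r1 Aab; apply: funcalcP; first exact: between_sa Aab.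
move=> e e0; have [p pr] := powR_poly_approx b a0 r1 e0.
by exists p => s /(between_spectrum Aab)/pr.
Qed.

(** A crude bound, s for s >= 1 and 1/s otherwise; it supplies the constant [C] of [fcalcM]. *)
Lemma powR_bounded r a b s : 0 < a -> `|r| <= 1 -> a <= s <= b ->
  `|s `^ r| <= b + a^-1.
Proof.
move=> a0; rewrite ler_norml => /andP[rN1 r1] /andP[as_ sb].
have s0 := lt_le_trans a0 as_.
rewrite ger0_norm ?powR_ge0 //; have [s1|/ltW s1] := leP 1 s.
  rewrite (le_trans (ler1_powR s1 r1)) // (le_trans sb) // lerDl invr_ge0 ltW //.
have := ger_powR (_ : 0 < s <= 1) rN1; rewrite s0 s1 => /(_ isT) /le_trans; apply.
rewrite powR_inv1 ?(ltW s0) // (@le_trans _ _ a^-1) ?lef_pV2 ?posrE //.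
by rewrite lerDr (le_trans (ltW s0)).
Qed.

Lemma bop_powN r a b A : 0 < a -> `|r| <= 1 -> between a b A ->
  bop_pow A r * bop_pow A (- r) = 1.
Proof.
move=> a0 r1 Aab; have sA := between_sa Aab.
have Nr1 : `|- r| <= 1 by rewrite normrN.
rewrite -(bop_horner1 A).
apply: (fcalc_eq sA (fcalcM (C := b + a^-1) (bop_powP a0 r1 Aab)
  (bop_powP a0 Nr1 Aab) _) (fcalc_horner _ _)).
  by move=> s /(between_spectrum Aab) sab; rewrite !powR_bounded.
move=> s /(between_spectrum Aab) /andP[/(lt_le_trans a0) s0 _].
by rewrite powRN divff ?gt_eqF ?powR_gt0 // hornerC.
Qed.

Lemma half_le1 : `|2^-1| <= 1 :> R.
Proof. by rewrite ger0_norm // invf_le1 // ler1n. Qed.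

Lemma bop_pow_half a b A : 0 < a -> between a b A ->
  bop_pow A 2^-1 * bop_pow A 2^-1 = A.
Proof.
move=> a0 Aab; have sA := between_sa Aab.
rewrite -[RHS](bop_hornerX A).
apply: (fcalc_eq sA (fcalcM (C := b + a^-1) (bop_powP a0 half_le1 Aab)
  (bop_powP a0 half_le1 Aab) _) (fcalc_horner _ _)).
  by move=> s /(between_spectrum Aab) sab; rewrite !powR_bounded ?half_le1.
move=> s /(between_spectrum Aab) /andP[/(lt_le_trans a0) s0 _].
by rewrite powR12_sqrt ?(ltW s0) // -expr2 sqr_sqrtr ?(ltW s0) // hornerX.
Qed.

Lemma bop_invP A : (exists V, is_inverse A V) -> is_inverse A (bop_inv A).
Proof. by move=> AV; rewrite /bop_inv; apply: xgetPex. Qed.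

Lemma is_inverse_sym A V : is_inverse A V -> is_inverse V A.
Proof. by case. Qed.

Lemma is_inverseE A V x : is_inverse A V -> V (A x) = x /\ A (V x) = x.
Proof. by move=> [VA AV]; rewrite -!bopME VA AV. Qed.

Lemma self_adjoint_inverse A V : self_adjoint A -> is_inverse A V -> self_adjoint V.
Proof.
move=> sA AV x y; have [_ {1}<-] := is_inverseE y AV.
by rewrite -sA; have [_ ->] := is_inverseE x AV.
Qed.

(** With x = Ay the bounds read |Ay|^2 <= b <Ay,y> and a <Ay,y> <= |Ay|^2; the first is
    [psd_norm_le], the second is s(s - a) >= 0 on the spectrum. *)
Lemma between_inverse a b A V : 0 < a -> 0 < b -> between a b A ->
  is_inverse A V -> between b^-1 a^-1 V.
Proof.
move=> a0 b0 Aab AV; have [sA aA Ab] := Aab.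
split=> [|x|x]; first exact: self_adjoint_inverse AV.
  have [_ <-] := is_inverseE x AV; have [-> _] := is_inverseE (V x) AV.
  rewrite [leRHS]ripC mulrC ler_pdivrMr // mulrC [rip (A _) (A _)]ripxx.
  exact: (psd_norm_le (ltW b0) sA (between_ge0 (ltW a0) Aab) Ab).
have [_ <-] := is_inverseE x AV; have [-> _] := is_inverseE (V x) AV.
move: (V x) => y; rewrite [leLHS]ripC [leRHS]mulrC ler_pdivlMr // mulrC.
have : 0 <= rip (bop_horner ('X * ('X - a%:P)) A y) y.
  apply: horner_between_ge0 Aab _ _ => s /andP[as_ _]; rewrite !hornerE.
  by rewrite mulr_ge0 ?subr_ge0 // (le_trans (ltW a0)).
rewrite bop_hornerM bop_hornerB bop_hornerX bop_hornerC bopME.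
have /self_adjointP -> := sA.
by rewrite bopBE bopZE bop1E ripBl ripZl (ripC y); lra.
Qed.

Lemma between_invertible a b A : 0 < a -> between a b A ->
  exists V, is_inverse A V.
Proof. by move=> a0 [sA aA _]; exact: coercive_invertible aA. Qed.

End Powers.

(** * The mean of [A^-1] and [B] as a solution of the Riccati equation X A X = B *)

Section GeometricMean.
Variables (R : realType) (H : hilbertType R).
Implicit Types (x y : H) (A B V X Z : bop H).

(* 0 <= (r X - V) A (r X - V). *)
Lemma riccati_amgm A B V X (r : R) x : 0 < r ->
  self_adjoint A -> (forall x, 0 <= rip (A x) x) -> self_adjoint X ->
  is_inverse A V -> X * A * X = B ->
  2 * r * rip (X x) x <= r ^+ 2 * rip (B x) x + rip (V x) x.
Proof.
move=> r0 /self_adjointP sA A0 /self_adjointP sX AV <-; rewrite !bopME.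
have [_ AVx] := is_inverseE x AV.
have := A0 (r%:C *: X x - V x).
rewrite bopB bopZ AVx !ripE (ripC x (X x)) (ripC x (V x)) -(sX _ x).
rewrite (sA (X x) (V x)) AVx; lra.
Qed.

Variables (m M : R).
Hypotheses (m_gt0 : 0 < m) (M_gt0 : 0 < M).

(** This is the overview's mu, not its k. *)
Let k : R := Num.sqrt (M / m).

(** This [r] makes r^2 M equal to 1/m, so both terms are at most 1/m, and r k = 1/m. Put into
    [riccati_amgm] it yields X <= k. *)
Lemma mean_ratio_bound (r b v : R) : r = (Num.sqrt (M * m))^-1 ->
  b <= M -> v <= m^-1 -> r ^+ 2 * b + v <= 2 * r * k.
Proof.
move=> -> bM vm; set s := Num.sqrt (M * m).
have Mm : 0 <= M * m by rewrite mulr_ge0 ?ltW.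
have s2 : s ^+ 2 = M * m by rewrite sqr_sqrtr.
have s0 : 0 < s by rewrite sqrtr_gt0 mulr_gt0.
have -> : k = s / m.
  apply: (@pexpIrn _ 2) => //; rewrite ?nnegrE ?sqrtr_ge0 ?divr_ge0 ?ltW //.
  rewrite exprMn s2 sqr_sqrtr ?divr_ge0 ?ltW //.
  by field; rewrite gt_eqF.
have -> : 2 * s^-1 * (s / m) = 2 * m^-1 by field; rewrite !gt_eqF.
have : s^-1 ^+ 2 * b <= m^-1.
  rewrite exprVn s2 mulrC ler_pdivrMr ?mulr_gt0 //.
  by rewrite mulrCA mulVf ?gt_eqF // mulr1.
lra.
Qed.

Lemma sqrt_between s : m ^+ 2 <= s <= M ^+ 2 -> m <= s `^ 2^-1 <= M.
Proof.
move=> /andP[ms sM]; rewrite powR12_sqrt ?(le_trans (sqr_ge0 m) ms) //.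
have -> : m = Num.sqrt (m ^+ 2) by rewrite sqrtr_sqr gtr0_norm.
have -> : M = Num.sqrt (M ^+ 2) by rewrite sqrtr_sqr gtr0_norm.
by rewrite !ler_wsqrtr.
Qed.

(** Two intervals for [X] are recorded: the sharp one controls the power in the sandwich inequality,
    the wider one carries the Kantorovich constant. [V] and [X] are variables so that callers can
    forget their definitions. *)
Lemma geo_mean_inv A B V X :
  between m M A -> between m M B -> V = bop_inv A -> X = geo_mean V B ->
  [/\ is_inverse A V, X * A * X = B, between k^-1 k X,
      between (m / M) (M / m) X &
      forall x, rip (B x) x + M * m * rip (V x) x <= (M + m) * rip (X x) x].
Proof.
move=> Amm Bmm defV defX; have [sA mA AM] := Amm; have [sB mB BM] := Bmm.
have AV : is_inverse A V.
  by rewrite defV; apply: bop_invP; exact: between_invertible Amm.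
have Vmm := between_inverse m_gt0 M_gt0 Amm AV; have [sV MV Vm] := Vmm.
have Mi0 : 0 < M^-1 by rewrite invr_gt0.
have Nh1 : `|- 2^-1| <= 1 :> R by rewrite normrN half_le1.
(* As V = A^-1, these are A^(-1/2) and A^(1/2). *)
pose a := bop_pow V 2^-1; pose b := bop_pow V (- 2^-1).
have aa : a * a = V by exact: bop_pow_half Vmm.
have ab : a * b = 1 by exact: bop_powN (half_le1 R) Vmm.
have ba : b * a = 1 by have := bop_powN Mi0 Nh1 Vmm; rewrite opprK.
have sa : self_adjoint a by apply: fcalc_self_adjoint sV (bop_powP _ (half_le1 R) Vmm).
have sb : self_adjoint b by apply: fcalc_self_adjoint sV (bop_powP _ Nh1 Vmm).
have XE : X = a * bop_pow (b * B * b) 2^-1 * a by rewrite defX.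
clearbody a b; clear defX.
have bb : b * b = A.
  have [_ AV1] := AV.
  rewrite -[LHS]mul1r -AV1 -aa -!mulrA (mulrA a b) ab mul1r.
  by rewrite ab mulr1.
have aAa : a * A * a = 1 by rewrite -bb mulrA ab mul1r ba.
have [D DE] : exists D, D = b * B * b by exists (b * B * b).
rewrite -DE in XE.
have Dmm : between (m ^+ 2) (M ^+ 2) D.
  have /self_adjointP sb' := sb.
  have Dx x : rip (D x) x = rip (B (b x)) (b x) by rewrite DE !bopME sb'.
  have bx x : rip (b x) (b x) = rip (A x) x by rewrite sb' -bopME bb ripC.
  split=> [|x|x]; first by rewrite DE; exact: self_adjoint_conj.
    rewrite Dx (le_trans _ (mB _)) // bx expr2 -mulrA.
    by rewrite ler_wpM2l // ltW.
  rewrite Dx (le_trans (BM _)) // bx expr2 -mulrA.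
  by rewrite ler_wpM2l // ltW.
have m2 : 0 < m ^+ 2 by rewrite exprn_gt0.
(* X = a W a, so [W] is A^(1/2) X A^(1/2); its bounds [m] and [M] come from m^2 <= D <= M^2. *)
set W := bop_pow D 2^-1 in XE.
have WW : W * W = D by exact: bop_pow_half Dmm.
have Wmm : between m M W.
  by apply: fcalc_between Dmm (bop_powP m2 (half_le1 R) Dmm) _ => s; exact: sqrt_between.
clearbody W.
have [sW mW WM] := Wmm.
have XAX : X * A * X = B.
  rewrite XE.
  have -> : a * W * a * A * (a * W * a) = a * W * (a * A * a) * W * a.
    by rewrite !mulrA.
  rewrite aAa mulr1 -(mulrA a W) WW DE !mulrA ab mul1r -mulrA ba mulr1 //.
have sX : self_adjoint X by rewrite XE; exact: self_adjoint_conj.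
have /self_adjointP sa' := sa.
have Xx x : rip (X x) x = rip (W (a x)) (a x) by rewrite XE !bopME sa'.
have ax x : rip (a x) (a x) = rip (V x) x by rewrite sa' -bopME aa ripC.
have XmM : between (m / M) (M / m) X.
  split=> // x.
    rewrite Xx (le_trans _ (mW _)) // ax -mulrA.
    by rewrite ler_wpM2l // ltW.
  rewrite Xx (le_trans (WM _)) // ax -mulrA.
  by rewrite ler_wpM2l // ltW.
have k0 : 0 < k by rewrite sqrtr_gt0 divr_gt0.
have s0 : 0 < Num.sqrt (M * m) by rewrite sqrtr_gt0 mulr_gt0.
pose r := (Num.sqrt (M * m))^-1; have r0 : 0 < r by rewrite invr_gt0.
(* General in its data because it serves twice: for [X], and for Z = X^-1, which solves Z B Z = A
   with the roles of [A] and [B] exchanged. *)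
have le_k (A' B' V' X' : bop H) : between m M A' -> between m M B' ->
    self_adjoint X' -> is_inverse A' V' -> X' * A' * X' = B' ->
    forall x, rip (X' x) x <= k * rip x x.
  move=> A'mm [_ _ B'M] sX' A'V' XAX' x.
  have [sA' _ _] := A'mm.
  have [_ _ V'm] := between_inverse m_gt0 M_gt0 A'mm A'V'.
  have := riccati_amgm x r0 sA' (between_ge0 (ltW m_gt0) A'mm) sX' A'V' XAX'.
  have [xx0|xx0] := eqVneq (rip x x) 0; first by rewrite (rip_eq0 xx0) bop0 !rip0r !mulr0.
  have xx : 0 < rip x x by rewrite lt_def xx0 ripxx_ge0.
  have := @mean_ratio_bound r (rip (B' x) x / rip x x) (rip (V' x) x / rip x x) erefl.
  rewrite !ler_pdivrMr // => /(_ (B'M x) (V'm x)) h1 h2.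
  rewrite -(ler_pM2l (_ : 0 < 2 * r)) ?mulr_gt0 // (le_trans h2) //.
  rewrite mulrA -ler_pdivrMr // mulrDl -mulrA //.
have mM0 : 0 < m / M by rewrite divr_gt0.
have Mm0 : 0 < M / m by rewrite divr_gt0.
split=> //.
- have [Z XZ] := between_invertible mM0 XmM.
  have [sZ Z1 Z2] := between_inverse mM0 Mm0 XmM XZ.
  have ZBZ : Z * B * Z = A.
    have [ZX XZ1] := XZ; rewrite -XAX !mulrA ZX mul1r -mulrA XZ1 mulr1 //.
  have [U BU] := between_invertible m_gt0 Bmm.
  have Zk : between (M / m)^-1 k Z by split=> //; exact: le_k Bmm Amm sZ BU ZBZ.
  have Mm0' : 0 < (M / m)^-1 by rewrite invr_gt0.
  have [_ Xk _] := between_inverse Mm0' k0 Zk (is_inverse_sym XZ).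
  by split=> //; exact: le_k Amm Bmm sX AV XAX.
move=> x; have : 0 <= rip (bop_horner (('X - m%:P) * (M%:P - 'X)) W (a x)) (a x).
  apply: horner_between_ge0 Wmm _ _ => s /andP[ms sM].
  by rewrite !hornerE mulr_ge0 ?subr_ge0.
rewrite bop_hornerM !bop_hornerB bop_hornerX !bop_hornerC bopME.
have /self_adjointP sW' := sW.
have BW : rip (B x) x = rip (W (a x)) (W (a x)).
  rewrite -XAX XE.
  have -> : a * W * a * A * (a * W * a) = a * W * (a * A * a) * W * a.
    by rewrite !mulrA.
  by rewrite aAa mulr1 !bopME sa' sW'.
rewrite BW Xx -ax !(bopBE, bopZE, bop1E) bopB bopZ !ripE (sW' (W (a x))); lra.
Qed.

End GeometricMean.

(** * Positive maps, the sandwich inequality and the Kantorovich constant *)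

Section PositiveMaps.
Variables (R : realType) (H K : hilbertType R) (Phi : {linear bop H -> bop K}).
Hypothesis Phi_pos : positive_map Phi.
Implicit Types (A S T V : bop H).

Lemma positive_map_ge0 T : self_adjoint T -> (forall x, 0 <= rip (T x) x) ->
  forall y, 0 <= rip (Phi T y) y.
Proof. by move=> sT T0; have /psdP[] := Phi_pos ((psdP T).2 (conj sT T0)). Qed.

(** For a norm bound [k], T + k is positive semi-definite, so [T] is a difference of two operators
    whose images are self-adjoint by positivity. *)
Lemma positive_map_sa T : self_adjoint T -> self_adjoint (Phi T).
Proof.
move=> sT; have [k k0 Tk] := bop_norm_le T.
have Phi_sa S : self_adjoint S -> (forall x, 0 <= rip (S x) x) -> self_adjoint (Phi S).
  by move=> sS S0; have [] := Phi_pos ((psdP S).2 (conj sS S0)).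
rewrite -(addrK (k%:C *: (1 : bop H)) T) linearB linearZ /=.
apply: self_adjointB.
  apply: Phi_sa => [|x]; first exact/self_adjointD/self_adjointZ.
  have := rip_norm_le x Tk.
  by rewrite bopDE bopZE bop1E ripDl ripZl ler_norml => /andP[]; lra.
by apply/self_adjointZ/Phi_sa => // x; exact: ripxx_ge0.
Qed.

Lemma positive_map_le S T : self_adjoint S -> self_adjoint T ->
  (forall x, rip (S x) x <= rip (T x) x) ->
  forall y, rip (Phi S y) y <= rip (Phi T y) y.
Proof.
move=> sS sT ST y; have := @positive_map_ge0 (T - S) (self_adjointB sT sS) _ y.
rewrite linearB bopBE ripBl subr_ge0; apply=> x.
by rewrite bopBE ripBl subr_ge0.
Qed.

Hypothesis Phi_unital : unital_map Phi.

Lemma positive_map_scalar c : Phi (c%:C *: (1 : bop H)) = c%:C *: (1 : bop K).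
Proof. by rewrite linearZ /= Phi_unital. Qed.

Lemma positive_map_between a b A : between a b A -> between a b (Phi A).
Proof.
move=> [sA aA Ab]; split=> [|y|y]; first exact: positive_map_sa.
  have := @positive_map_le (a%:C *: (1 : bop H)) A _ sA _ y.
  rewrite positive_map_scalar bopZE bop1E ripZl; apply; first exact: self_adjointZ.
  by move=> x; rewrite bopZE bop1E ripZl.
have := @positive_map_le A (b%:C *: (1 : bop H)) sA _ _ y.
rewrite positive_map_scalar bopZE bop1E ripZl; apply; first exact: self_adjointZ.
by move=> x; rewrite bopZE bop1E ripZl.
Qed.

(** Average x^2/z = 2x - z + (z - x)^2/z over the nodes z: their mean is x and 1/z <= 1/a, so only
    variance / a remains. *)
Lemma bernstein_inverse_le (a w x : R) n : 0 < a -> 0 < w -> a <= x <= a + w ->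
  x * (\sum_(k < n.+2) (bernstein_node a w n.+1 k)^-1 *: bernstein a w n.+1 k).[x] * x
  <= x + w ^+ 2 / n.+1%:R / a.
Proof.
move=> a0 w0 axw.
have x0 : 0 < x by case/andP: axw => + _; exact: lt_le_trans.
rewrite horner_sum mulr_sumr mulr_suml.
apply: (@le_trans _ _ (\sum_(k < n.+2) (2 * x * (bernstein a w n.+1 k).[x]
   - (bernstein a w n.+1 k).[x] * bernstein_node a w n.+1 k
   + a^-1 * ((bernstein a w n.+1 k).[x] * (bernstein_node a w n.+1 k - x) ^+ 2)))).
  apply: ler_sum => k _; rewrite hornerZ.
  have b0 := bernstein_ge0 w0 n.+1 k axw; move: b0.
  have := bernstein_node_ge a w0 n.+1 k.
  move: (bernstein_node _ _ _ _) (_.[x]) => z b az b0.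
  have z0 := lt_le_trans a0 az.
  have -> : x * (z^-1 * b) * x = 2 * x * b - b * z + z^-1 * (b * (z - x) ^+ 2).
    by field; rewrite gt_eqF.
  rewrite lerD2l; apply: ler_wpM2r; first exact: mulr_ge0 b0 (sqr_ge0 _).
  by rewrite lef_pV2.
rewrite big_split /= sumrB -!mulr_sumr -horner_sum sum_bernstein hornerC mulr1.
rewrite bernstein_mean // mulrC [leRHS]addrC (_ : x * 2 - x = x); last by ring.
rewrite addrC lerD2r mulrC ler_wpM2r ?invr_ge0 ?(ltW a0) //.
exact: bernstein_variance.
Qed.

(* Choi's inequality Phi(A)^-1 <= Phi(A^-1).  Bernstein polynomials of A play the
   role of spectral projections: the E_k are positive, sum to 1, and satisfy
   sum_k x_k E_k = A and sum_k x_k^-1 E_k <= A^-1 + O(1/n). *)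
Lemma positive_map_inverse (a b : R) A V (v w : K) :
  0 < a -> between a b A -> is_inverse A V ->
  2 * rip w v <= rip (Phi A w) w + rip (Phi V v) v.
Proof.
move=> a0 Aab AV; pose l : R := `|b - a| + 1.
have l0 : 0 < l by rewrite ltr_wpDl.
have Aal : between a (a + l) A.
  have [sA aA Ab] := Aab; split=> // x; rewrite (le_trans (Ab x)) //.
  rewrite ler_wpM2r ?ripxx_ge0 // -lerBlDl /l; have := ler_norm (b - a); lra.
have sA := between_sa Aab; have sV := self_adjoint_inverse sA AV.
have /self_adjointP sV' := sV; have /self_adjointP sA' := sA.
pose q := rip (Phi (V * V) v) v.
have sVV : self_adjoint (V * V) by exact: self_adjointM.
have q0 : 0 <= q.
  by apply: positive_map_ge0 => // x; rewrite bopME sV' ripxx_ge0.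
apply/ler_addgt0Pr => e e0.
(* Replacing the inverse [V] by the node sum [T] costs at most d V^2 with d = l^2 / ((n+1) a); this
   [n] makes its image at [v] at most [e]. *)
pose n := Num.truncn (l ^+ 2 / a * q / e).
have ne : l ^+ 2 / n.+1%:R / a * q <= e.
  have -> : l ^+ 2 / n.+1%:R / a * q = l ^+ 2 / a * q / n.+1%:R by ring.
  rewrite ler_pdivrMr ?ltr0Sn // [leRHS]mulrC -ler_pdivrMr //.
  exact/ltW/truncnS_gt.
clearbody n.
pose xk k := bernstein_node a l n.+1 k.
pose E k := bop_horner (bernstein a l n.+1 k) A.
have xk0 k : 0 < xk k by exact: lt_le_trans a0 (bernstein_node_ge _ l0 _ _).
have sE k : self_adjoint (E k) by exact: self_adjoint_horner.
have PhiE k y : 0 <= rip (Phi (E k) y) y.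
  apply: positive_map_ge0 => // x.
  by apply: horner_between_ge0 Aal _ _ => s; exact: bernstein_ge0.
have sumE (c : nat -> R) y z : rip (Phi (\sum_(k < n.+2) (c k)%:C *: E k) y) z
    = \sum_(k < n.+2) c k * rip (Phi (E k) y) z.
  rewrite linear_sum bop_sumE rip_suml; apply: eq_bigr => k _.
  by rewrite linearZ bopZE ripZl.
have E1 y z : \sum_(k < n.+2) 1 * rip (Phi (E k) y) z = rip y z.
  rewrite -(sumE (fun=> 1)) (_ : \sum_(k < n.+2) _ = 1) ?Phi_unital //.
  rewrite -[RHS](bop_horner1 A) -(sum_bernstein a l n.+1) bop_horner_sum.
  by apply: eq_bigr => k _; rewrite scale1r.
have EA : \sum_(k < n.+2) (xk k)%:C *: E k = A.
  transitivity (bop_horner (\sum_(k < n.+2) xk k *: bernstein a l n.+1 k) A).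
    by rewrite bop_horner_sum; apply: eq_bigr => k _; rewrite bop_hornerZ.
  rewrite -[RHS]bop_hornerX.
  apply: (fcalc_eq sA (fcalc_horner _ _) (fcalc_horner _ _)) => s _.
  rewrite horner_sum hornerX -[RHS](bernstein_mean a l0 n).
  by apply: eq_bigr => k _; rewrite hornerZ mulrC.
pose T := \sum_(k < n.+2) (xk k)^-1%:C *: E k.
have sT : self_adjoint T.
  rewrite /T; elim/big_ind: _ => [|? ? |k _]; first exact: self_adjoint0.
    exact: self_adjointD.
  exact: self_adjointZ.
pose d := l ^+ 2 / n.+1%:R / a.
have TV x : rip (T x) x <= rip ((V + d%:C *: (V * V)) x) x.
  pose p := \sum_(k < n.+2) (xk k)^-1 *: bernstein a l n.+1 k.
  have TE : T = bop_horner p A.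
    by rewrite bop_horner_sum; apply: eq_bigr => k _; rewrite bop_hornerZ.
  (* The scalar bound s p(s) s <= s + d, taken at [V x], loses its outer factors because A V = 1. *)
  have : 0 <= rip (bop_horner ('X + d%:P - 'X * p * 'X) A (V x)) (V x).
    apply: horner_between_ge0 Aal _ _ => s sl.
    rewrite hornerD hornerN hornerD hornerX hornerC !hornerM hornerX subr_ge0.
    exact: bernstein_inverse_le.
  rewrite bop_hornerB bop_hornerD !bop_hornerM bop_hornerX bop_hornerC -TE.
  have [_ AVx] := is_inverseE x AV.
  rewrite bopBE bopDE bopZE bop1E !bopME AVx ripBl ripDl ripZl (sA' (T x)) AVx.
  by rewrite bopDE bopZE bopME ripDl ripZl (sV' (V x)) (ripC x (V x)); lra.
have : rip (Phi T v) v <= rip (Phi V v) v + e.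
  have := positive_map_le sT (self_adjointD sV (self_adjointZ d sVV)) TV v.
  rewrite linearD linearZ bopDE bopZE ripDl ripZl => /le_trans; apply.
  by rewrite lerD2l.
(* Completed squares: expanding them collects Phi(A), the identity and Phi(T), with weights x_k, 1
   and 1/x_k. *)
have : 0 <= \sum_(k < n.+2) xk k * rip (Phi (E k) (w - (xk k)^-1%:C *: v))
    (w - (xk k)^-1%:C *: v).
  by apply: sumr_ge0 => k _; rewrite mulr_ge0 // ltW.
have -> : \sum_(k < n.+2) xk k * rip (Phi (E k) (w - (xk k)^-1%:C *: v))
    (w - (xk k)^-1%:C *: v) = \sum_(k < n.+2) (xk k * rip (Phi (E k) w) w
      - 2 * (1 * rip (Phi (E k) w) v) + (xk k)^-1 * rip (Phi (E k) v) v).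
  apply: eq_bigr => k _; have /self_adjointP sP := positive_map_sa (sE k).
  rewrite bopB bopZ !ripE (sP v w) (ripC v).
  by field; rewrite gt_eqF.
rewrite big_split sumrB /= -mulr_sumr E1.
by rewrite -(sumE xk) EA -(sumE (fun k => (xk k)^-1)) -/T; lra.
Qed.

End PositiveMaps.

(** * A Kantorovich inequality for two noncommuting operators *)

Section Sandwich.
Variables (R : realType) (H : hilbertType R).
Implicit Types (x : H) (P N E F G : bop H) (p d mu : R).

(* T = P G P + F satisfies T P^-1 T <= d p T because F G >= 0; conclude by
   Cauchy-Schwarz for P^-1. *)
Lemma complementary_sandwich P F G p d x : 1 <= p -> 0 <= d ->
  between p^-1 p P -> self_adjoint F -> self_adjoint G ->
  (forall y, 0 <= rip (F y) y) -> (forall y, 0 <= rip (G y) y) ->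
  (forall y, F y = d%:C *: y - G y) ->
  rip (G (P x)) (P x) + rip (F x) x <= d * p * rip (P x) x.
Proof.
move=> p1 d0 Pp sF sG F0 G0 FG.
have p0 : 0 < p by exact: lt_le_trans p1.
have pi0 : 0 < p^-1 by rewrite invr_gt0.
have [sP _ _] := Pp.
have [N PN] := between_invertible pi0 Pp.
have Np := between_inverse pi0 p0 Pp PN; have [sN _ Nle] := Np.
rewrite invrK in Nle; have [_ _ Ple] := Pp.
have /self_adjointP sF' := sF; have /self_adjointP sG' := sG.
have /self_adjointP sP' := sP; have /self_adjointP sN' := sN.
have GF y : F (G y) = G (F y) by rewrite !FG bopB bopZ.
(* The form of FG. Since F = d - G commutes with G, it is symmetric and C(y,y) = d <Gy,y> - |Gy|^2
   >= 0. *)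
pose C y z := rip (F (G y)) z.
have C_diagG y : C y y = d * rip (G y) y - rip (G y) (G y).
  by rewrite /C FG ripBl ripZl (sG' (G y)).
have C_diagF y : C y y = d * rip (F y) y - rip (F y) (F y).
  by rewrite /C GF sG' [G y](_ : _ = d%:C *: y - F y) ?ripBr ?ripZr // FG subKr.
have Gd y : rip (G y) y <= d * rip y y by have := F0 y; rewrite FG ripBl ripZl; lra.
have C0 y : 0 <= C y y.
  rewrite C_diagG subr_ge0 ripxx; exact: (psd_norm_le d0 sG G0 Gd).
pose z := P x; pose g := G z; pose f := F x; pose u := P g + f.
have ux : rip u x = rip (G z) z + rip (F x) x by rewrite /u ripDl sP'.
have Cz : C (z - x) (z - x) = C z z + C x x - 2 * C z x.
  rewrite /C !bopB !ripBl !ripBr.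
  have -> : rip (F (G x)) z = rip (F (G z)) x by rewrite GF sG' sF' ripC.
  by ring.
(* Here u = Tx. Bounding P and N by p leaves p(|g|^2 + |f|^2) + 2 C(z,x), which equals d p <u,x> -
   p(C(z,z) + C(x,x)) + 2 C(z,x); as p >= 1 and C(z-x,z-x) >= 0, the C-terms are nonpositive in
   total. *)
have Nu : rip (N u) u <= d * p * rip u x.
  have [NPg _] := is_inverseE g PN.
  have NuE : rip (N u) u = rip (P g) g + 2 * rip g f + rip (N f) f.
    rewrite /u bopD NPg ripDl !ripDr (sN' f) NPg (ripC g (P g)) (ripC f g); ring.
  have gf : rip g f = C z x by rewrite /C -sF'.
  have := Ple g; have := Nle f; have := C_diagG z; have := C_diagF x.
  have := C0 (z - x); rewrite Cz NuE gf ux -/g -/f.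
  have := C0 z; have := C0 x; move: (C z z) (C x x) (C z x) => czz cxx czx.
  move: (rip g g) (rip f f) (rip (P g) g) (rip (N f) f) (rip (G z) z) (rip f x).
  move=> gg ff pg nf gz fx cx0 cz0 h1 h2 h3 h4 h5.
  have : 0 <= (p - 1) * (czz + cxx) by rewrite mulr_ge0 ?subr_ge0 ?addr_ge0.
  rewrite {1}h2 {1}h3.
  have : p * gg = p * (d * gz - czz) by rewrite h3; ring.
  have : p * ff = p * (d * fx - cxx) by rewrite h2; ring.
  lra.
have [NPx _] := is_inverseE x PN.
have := psd_cauchy u (P x) sN (between_ge0 (ltW (_ : 0 < p^-1)) Np) => /(_ pi0).
rewrite sN' NPx (ripC x) => uxPx.
have Px0 : 0 <= rip (P x) x by exact: between_ge0 (ltW pi0) Pp x.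
rewrite -ux; have [ux0|ux0] := leP (rip u x) 0.
  by rewrite (le_trans ux0) // !mulr_ge0 // ltW.
rewrite -(ler_pM2l ux0) -expr2 (le_trans uxPx) //.
by have := ler_wpM2r Px0 Nu; lra.
Qed.

(** Take F = E - 1/mu and G = mu - E, with sum d = mu - 1/mu, and add 1/mu times (P - 1/p)(p - P) >=
    0. The coefficients combine to (mu - 1/mu) p + (p + 1/p)/mu = p mu + 1/(p mu). *)
Lemma kantorovich_sandwich P E p mu x : 1 <= p -> 1 <= mu ->
  between p^-1 p P -> between mu^-1 mu E ->
  (mu + mu^-1) * rip (P x) (P x) - rip (E (P x)) (P x) + rip (E x) x
  <= (p * mu + (p * mu)^-1) * rip (P x) x.
Proof.
move=> p1 mu1 Pp [sE muE Emu].
have p0 : 0 < p by exact: lt_le_trans p1.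
have mu0 : 0 < mu by exact: lt_le_trans mu1.
have mui : mu^-1 <= mu by rewrite (le_trans _ mu1) // invf_le1.
have s1 c : self_adjoint (c%:C *: (1 : bop H)) by exact: self_adjointZ.
have := @complementary_sandwich P (E - mu^-1%:C *: (1 : bop H))
  (mu%:C *: (1 : bop H) - E) p (mu - mu^-1) x p1 _ Pp
  (self_adjointB sE (s1 _)) (self_adjointB (s1 _) sE).
rewrite !(bopBE, bopZE, bop1E) !ripE subr_ge0 => /(_ mui) h.
have {h} : mu * rip (P x) (P x) - rip (E (P x)) (P x) + (rip (E x) x - mu^-1 * rip x x)
    <= (mu - mu^-1) * p * rip (P x) x.
  apply: h => y; rewrite !(bopBE, bopZE, bop1E) ?ripE ?subr_ge0 //.
  by rewrite opprB rmorphB scalerBl [in RHS]addrC addrA subrK.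
have : 0 <= rip (bop_horner (('X - p^-1%:P) * (p%:P - 'X)) P x) x.
  apply: horner_between_ge0 Pp _ _ => s /andP[ps sp].
  by rewrite !hornerE mulr_ge0 ?subr_ge0.
have /self_adjointP sP := between_sa Pp.
rewrite bop_hornerM !bop_hornerB bop_hornerX !bop_hornerC bopME.
rewrite !(bopBE, bopZE, bop1E) bopB bopZ !ripE (sP (P x)) => h1 h2.
have pp : p^-1 * (p * rip x x) = rip x x by rewrite mulKf // gt_eqF.
have imu0 : 0 < mu^-1 by rewrite invr_gt0.
have : mu^-1 * (rip (P x) (P x) + rip x x) <= mu^-1 * ((p + p^-1) * rip (P x) x).
  by rewrite ler_pM2l //; lra.
have : mu^-1 * (p * mu) = p by field; rewrite gt_eqF.
rewrite invfM; lra.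
Qed.

End Sandwich.

Section KantorovichConstant.
Variable R : realType.
Implicit Types (a b t x : R).

(* K is the least ratio of the chord of s^t on [a, b] to s^t: weighted AM-GM. *)
Lemma kantorovich_chord a b t : 0 < a -> a <= b -> 0 <= t -> t <= 1 ->
  exists al be, [/\ 0 <= al, 0 < kantorovich a b t,
    forall x, a <= x <= b -> al * x + be <= x `^ t &
    forall x, 0 < x -> kantorovich a b t * x `^ t <= al * x + be].
Proof.
move=> a0 ab t0 t1; rewrite /kantorovich.
have [->|tN0] := eqVneq t 0.
  by exists 0, 1; split=> //= x _; rewrite powRr0 mul0r add0r ?mul1r lexx.
have [->|tN1] := eqVneq t 1.
  exists 1, 0; split=> //= x xab; rewrite powRr1 ?mul1r ?addr0 ?lexx //.
    by case/andP: xab => /(le_trans (ltW a0)).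
  exact: ltW.
have [<-|aNb] /= := eqVneq a b.
  (* On a degenerate interval the chord becomes the tangent at [a]. *)
  exists (t * (a `^ t / a)), ((1 - t) * a `^ t); split=> //.
  - by rewrite mulr_ge0 ?divr_ge0 ?powR_ge0 ?(ltW a0).
  - move=> x /le_anti <-; rewrite (_ : _ + _ = a `^ t) ?lexx //.
    by field; rewrite gt_eqF.
  - move=> x x0; have := powR_tangent t0 t1 a0 x0.
    rewrite mul1r => /le_trans; apply.
    by rewrite le_eqVlt; apply/orP; left; apply/eqP; ring.
have {}t0 : 0 < t by rewrite lt_def tN0.
have {tN1}t1 : t < 1 by rewrite lt_def eq_sym tN1.
have {aNb}ab : a < b by rewrite lt_def eq_sym aNb.
have b0 := lt_trans a0 ab.
have at0 := powR_gt0 t a0; have bt0 := powR_gt0 t b0.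
have abt : a `^ t < b `^ t by rewrite gt0_ltr_powR ?nnegrE ?(ltW a0) ?(ltW b0).
have bat : a * b `^ t < b * a `^ t.
  have aE : a = a `^ (1 - t) * a `^ t.
    by rewrite -powRD ?subrK ?powRr1 ?(ltW a0) // (gt_eqF a0) implybT.
  have bE : b = b `^ (1 - t) * b `^ t.
    by rewrite -powRD ?subrK ?powRr1 ?(ltW b0) // (gt_eqF b0) implybT.
  rewrite {1}aE {2}bE -!mulrA (mulrC (b `^ t)) ltr_pM2r ?mulr_gt0 //.
  by rewrite gt0_ltr_powR ?nnegrE ?(ltW a0) ?(ltW b0) ?subr_gt0.
have ba0 : 0 < b - a by rewrite subr_gt0.
(* Slope and intercept of the chord; the intercept is positive because s^t / s decreases. *)
pose al := (b `^ t - a `^ t) / (b - a); pose be := (b * a `^ t - a * b `^ t) / (b - a).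
have al0 : 0 < al by rewrite divr_gt0 ?subr_gt0.
have be0 : 0 < be by rewrite divr_gt0 ?subr_gt0.
have t1' : 0 < 1 - t by rewrite subr_gt0.
have -> : (a * b `^ t - b * a `^ t) / ((t - 1) * (b - a)) = be / (1 - t).
  rewrite /be; field; rewrite !subr_eq0 (gt_eqF ab) (lt_eqF t1) /=.
  by rewrite eq_sym (lt_eqF t1).
have -> : (t - 1) / t * ((b `^ t - a `^ t) / (a * b `^ t - b * a `^ t))
    = (1 - t) * al / (t * be).
  rewrite /be /al; field; rewrite !subr_eq0 (gt_eqF ab) (lt_eqF bat) (gt_eqF bat).
  by rewrite (gt_eqF t0).
exists al, be; split; first exact: ltW.
- apply: mulr_gt0; first exact: divr_gt0.
  by apply/powR_gt0/divr_gt0; exact: mulr_gt0.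
- move=> x /andP[ax xb]; have x0 := lt_le_trans a0 ax.
  have -> : al * x + be = ((b - x) * a `^ t + (x - a) * b `^ t) / (b - a).
    by rewrite /al /be; field; rewrite gt_eqF.
  rewrite ler_pdivrMr //.
  have := ler_wpM2l (_ : 0 <= b - x) (powR_tangent (ltW t0) (ltW t1) x0 a0).
  have := ler_wpM2l (_ : 0 <= x - a) (powR_tangent (ltW t0) (ltW t1) x0 b0).
  rewrite !subr_ge0 => /(_ ax) h1 /(_ xb) h2.
  apply: le_trans (lerD h2 h1) _; rewrite le_eqVlt; apply/orP; left; apply/eqP.
  by field; rewrite gt_eqF.
move=> x x0; rewrite -mulrA -powRM ?(ltW x0) //; last first.
  by apply/ltW/divr_gt0; apply: mulr_gt0.
(* Normalized so that the minimal ratio of chord to power is attained at y = 1; the claim is then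
   the tangent bound y^t <= 1 - t + t y times be / (1 - t). *)
set y := (1 - t) * al / (t * be) * x.
have y0 : 0 < y by apply: mulr_gt0 => //; apply: divr_gt0; exact: mulr_gt0.
have := powR_tangent (ltW t0) (ltW t1) ltr01 y0; rewrite powR1 mul1r divr1.
have bt : 0 < be / (1 - t) by rewrite divr_gt0.
move=> /(ler_wpM2l (ltW bt)) /le_trans; apply.
rewrite le_eqVlt; apply/orP; left; apply/eqP; rewrite /y.
by field; rewrite (gt_eqF be0) (gt_eqF t0) (gt_eqF t1').
Qed.

End KantorovichConstant.

(** * The main inequality *)

Section WeightedPower.
Variables (R : realType) (H : hilbertType R).
Implicit Types (x : H) (A B V X : bop H) (a b t : R).

Lemma affine_fcalc (al be : R) A x :
  rip (bop_horner (al *: 'X + be%:P) A x) x = al * rip (A x) x + be * rip x x.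
Proof.
by rewrite bop_hornerD bop_hornerZ bop_hornerX bop_hornerC bopDE !bopZE ripDl !ripZl.
Qed.

Lemma between_pow a t A : 0 < a -> 0 <= t -> t <= 1 -> between a^-1 a A ->
  between (a `^ t)^-1 (a `^ t) (bop_pow A t).
Proof.
move=> a0 t0 t1 Aa; have a0' : 0 < a^-1 by rewrite invr_gt0.
have t1' : `|t| <= 1 by rewrite ger0_norm.
apply: fcalc_between Aa (bop_powP a0' t1' Aa) _ => s /andP[as_ sa].
have s0 := lt_le_trans a0' as_.
have aiE : (a `^ t)^-1 = a^-1 `^ t by rewrite -powRN -mulN1r powRrM powR_inv1 ?(ltW a0).
rewrite aiE !ge0_ler_powR ?nnegrE ?(ltW s0) ?(ltW a0) ?(ltW a0') //.
Qed.

(* (s - m)(M - s) >= 0 divided by s. *)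
Lemma between_add_inverse m M A V x : 0 < m -> between m M A -> is_inverse A V ->
  rip (A x) x + M * m * rip (V x) x <= (M + m) * rip x x.
Proof.
move=> m0 Amm AV; have [_ <-] := is_inverseE x AV; have [-> _] := is_inverseE (V x) AV.
move: (V x) => y.
have : 0 <= rip (bop_horner (('X - m%:P) * 'X * (M%:P - 'X)) A y) y.
  apply: horner_between_ge0 Amm _ _ => s /andP[ms sM].
  by rewrite !hornerE !mulr_ge0 ?subr_ge0 // (le_trans (ltW m0)).
have /self_adjointP sA := between_sa Amm.
rewrite !bop_hornerM !bop_hornerB bop_hornerX !bop_hornerC !bopME.
rewrite !(bopBE, bopZE, bop1E) !bopB !bopZ !ripE.
by rewrite (sA (A (A y)) y) (sA (A y) y) (ripC y (A y)); lra.
Qed.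

(* 0 <= (X - s V) A (X - s V). *)
Lemma sandwich_ge A V X (s : R) x : self_adjoint A -> (forall y, 0 <= rip (A y) y) ->
  self_adjoint X -> is_inverse A V ->
  2 * s * rip (X x) x - s ^+ 2 * rip (V x) x <= rip ((X * A * X) x) x.
Proof.
move=> /self_adjointP sA A0 /self_adjointP sX AV; rewrite !bopME (sX (A (X x))).
have [_ AVx] := is_inverseE x AV.
have := A0 (X x - s%:C *: V x).
by rewrite bopB bopZ AVx !ripE (sA (X x) (V x)) AVx (ripC x) (ripC x (V x)); lra.
Qed.

End WeightedPower.

Theorem theorem2p4 (R : realType) (H K : hilbertType R) (A B : bop H) (m M : R)
    (Phi : {linear bop H -> bop K}) (t : R)
    (posA : posdef A) (posB : posdef B) (m_gt0 : 0 < m)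
    (mA : bop_le (m%:C *: (1 : bop H)) A) (AM : bop_le A (M%:C *: (1 : bop H)))
    (mB : bop_le (m%:C *: (1 : bop H)) B) (BM : bop_le B (M%:C *: (1 : bop H)))
    (Phi_pos : positive_map Phi) (Phi_unital : unital_map Phi)
    (t_ge0 : 0 <= t) (t_le1 : t <= 1) :
  bop_le (spectral_geo_mean t (Phi A) (Phi B))
    ((1 / kantorovich (m / M) (M / m) t ^+ 2
      * ((M + m) / (2 * Num.sqrt (M * m))) `^ (2 * t)
      * ((M `^ (1 + t) + m `^ (1 + t)) ^+ 2
         / (4 * (M `^ (1 + t) * m `^ (1 + t)))))%:C
     *: Phi (spectral_geo_mean t A B)).
Proof.
have s1 c : self_adjoint (c%:C *: (1 : bop H)) by exact: self_adjointZ.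
have between_of (S : bop H) : posdef S -> bop_le (m%:C *: (1 : bop H)) S ->
    bop_le S (M%:C *: (1 : bop H)) -> between m M S.
  move=> [[sS _] _] /(bop_leP (s1 _) sS) mS /(bop_leP sS (s1 _)) SM.
  by split=> // x; [have := mS x|have := SM x]; rewrite bopZE bop1E ripZl.
have {posA mA AM} Amm := between_of A posA mA AM.
have {posB mB BM} Bmm := between_of B posB mB BM.
have [Mm|mM] := ltP M m.
  (* If M < m the bounds force the zero space, and unitality of [Phi] then makes every operator on
     [K] zero. *)
  have H0 (x : H) : x = 0.
    apply: rip_eq0; apply/eqP; rewrite eq_le ripxx_ge0 andbT.
    have [_ mx xM] := Amm; rewrite -(pmulr_rle0 _ (_ : 0 < m - M)) ?subr_gt0 //.
    by rewrite mulrBl subr_le0 (le_trans (mx x)).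
  have bop0' (S : bop K) : S = 0.
    rewrite -[S]mul1r -Phi_unital (_ : 1 = 0 :> bop H) ?linear0 ?mul0r //.
    by apply: bop_ext => x; rewrite [LHS]H0.
  rewrite /bop_le [X in psd X]bop0'; apply/psdP; split=> [|x]; first exact: self_adjoint0.
  by rewrite rip0l.
have M_gt0 : 0 < M by exact: lt_le_trans mM.
have A1mm := positive_map_between Phi_pos Phi_unital Amm.
have B1mm := positive_map_between Phi_pos Phi_unital Bmm.
have [sA _ _] := Amm; have [sA1 _ _] := A1mm.
pose V := bop_inv A; pose X := geo_mean V B.
pose V1 := bop_inv (Phi A); pose Y := geo_mean V1 (Phi B).
have [AV _ _ XmM BX] := geo_mean_inv m_gt0 M_gt0 Amm Bmm (erefl V) (erefl X).
have [A1V1 YAY Ymu YmM _] := geo_mean_inv m_gt0 M_gt0 A1mm B1mm (erefl V1) (erefl Y).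
rewrite /spectral_geo_mean -/V -/X -/V1 -/Y; clearbody V X V1 Y.
have [sX _ _] := XmM; have [sY _ _] := YmM.
have sV := self_adjoint_inverse sA AV.
have mM_gt0 : 0 < m / M by rewrite divr_gt0.
have Mm_gt0 : 0 < M / m by rewrite divr_gt0.
have mM_le : m / M <= M / m.
  rewrite ler_pdivrMr // mulrAC ler_pdivlMr // -!expr2.
  by rewrite ler_pXn2r ?nnegrE ?(ltW m_gt0) ?(ltW M_gt0).
have t_norm : `|t| <= 1 by rewrite ger0_norm.
have [al [be [al_ge0 K_gt0 chord_le chord_ge]]] :=
  kantorovich_chord mM_gt0 mM_le t_ge0 t_le1.
set kant := kantorovich _ _ _ in K_gt0 chord_ge *.
pose sg := Num.sqrt (M * m); pose mu := Num.sqrt (M / m).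
have sg_gt0 : 0 < sg by rewrite sqrtr_gt0 mulr_gt0.
have sg2 : sg ^+ 2 = M * m by rewrite sqr_sqrtr // mulr_ge0 // ltW.
have mu_gt0 : 0 < mu by rewrite sqrtr_gt0.
have mu2 : mu ^+ 2 = M / m by rewrite sqr_sqrtr // ltW.
have mu_sg : sg * mu = M.
  apply: (@pexpIrn _ 2) => //;
    rewrite ?nnegrE ?mulr_ge0 ?(ltW sg_gt0) ?(ltW mu_gt0) ?(ltW M_gt0) //.
  by rewrite exprMn sg2 mu2; field; rewrite gt_eqF.
have mu_sg' : sg / mu = m.
  have : sg * mu * (sg / mu) = M * m by rewrite -sg2; field; rewrite gt_eqF.
  by rewrite mu_sg; move/mulfI; apply; rewrite gt_eqF.
have mu_ge1 : 1 <= mu.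
  rewrite -(ler_pXn2r (ltn0Sn 1)) ?nnegrE ?(ltW mu_gt0) // mu2 expr1n.
  by rewrite ler_pdivlMr // mul1r.
pose ka := (M + m) / (2 * sg); pose c := ka `^ t / kant.
have ka_gt0 : 0 < ka by rewrite divr_gt0 ?addr_gt0 ?mulr_gt0.
have c_gt0 : 0 < c by rewrite divr_gt0 ?powR_gt0.
pose E := Phi V.
have Vmm := between_inverse m_gt0 M_gt0 Amm AV.
have [sE ME Em] : between M^-1 m^-1 E by exact: positive_map_between.
have Phi_comb (a b : R) (S T : bop H) (x : K) :
    rip (Phi (a%:C *: S + b%:C *: T) x) x = a * rip (Phi S x) x + b * rip (Phi T x) x.
  by rewrite linearD !linearZ bopDE !bopZE ripDl !ripZl.
have Phi_affine (a b : R) (S : bop H) (x : K) :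
    rip (Phi (a%:C *: S + b%:C *: (1 : bop H)) x) x = a * rip (Phi S x) x + b * rip x x.
  by rewrite Phi_comb Phi_unital bop1E.
have saff (a b : R) (S : bop H) :
    self_adjoint S -> self_adjoint (a%:C *: S + b%:C *: (1 : bop H)).
  by move=> sS; apply: self_adjointD; exact: self_adjointZ.
have V1E x : rip (V1 x) x <= rip (E x) x.
  (* At w = [V1 x] and v = [x] the term <Phi(A)w,w> is <V1 x,x>, which cancels one of the two copies
     on the left. *)
  have := positive_map_inverse Phi_pos Phi_unital x (V1 x) m_gt0 Amm AV.
  by have [_ ->] := is_inverseE x A1V1; rewrite -/E (ripC x); lra.
have Y_le x : rip (Y x) x <= ka * rip (Phi X x) x.
  have sgi : 0 < sg^-1 by rewrite invr_gt0.
  (* AM-GM at r = 1/sg; multiplied by sg^2 = Mm it becomes the form used in the overview. *)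
  have := riccati_amgm x sgi sA1 (between_ge0 (ltW m_gt0) A1mm) sY A1V1 YAY.
  have : rip (Phi (1%:C *: B + (M * m)%:C *: V) x) x <= rip (Phi ((M + m)%:C *: X) x) x.
    have [sB _ _] := Bmm; apply: positive_map_le => // [||z].
    - by apply: self_adjointD; exact: self_adjointZ.
    - exact: self_adjointZ.
    by rewrite bopDE !bopZE ripDl !ripZl mul1r; exact: BX.
  rewrite Phi_comb linearZ bopZE ripZl mul1r -/E => h1 h2.
  have := V1E x; rewrite -(ler_pM2l (mulr_gt0 M_gt0 m_gt0)) => h3.
  rewrite -(ler_pM2l (_ : 0 < 2 * sg)) ?mulr_gt0 //.
  have -> : 2 * sg * (ka * rip (Phi X x) x) = (M + m) * rip (Phi X x) x.
    by rewrite /ka; field; rewrite gt_eqF.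
  have := ler_wpM2l (ltW (mulr_gt0 M_gt0 m_gt0)) h2.
  rewrite mulrDr -{1 2}sg2.
  have -> : sg ^+ 2 * (2 * sg^-1 * rip (Y x) x) = 2 * sg * rip (Y x) x.
    by field; rewrite gt_eqF.
  have -> : sg ^+ 2 * (sg^-1 ^+ 2 * rip (Phi B x) x) = rip (Phi B x) x.
    by field; rewrite gt_eqF.
  by lra.
pose P := bop_pow Y t; pose Xt := bop_pow X t.
have fP := bop_powP mM_gt0 t_norm YmM; have fXt := bop_powP mM_gt0 t_norm XmM.
have sXt : self_adjoint Xt by exact: fcalc_self_adjoint sX fXt.
have P_le x : rip (P x) x <= c * rip (Phi Xt x) x.
  have h1 : rip (P x) x <= c * (al / ka) * rip (Y x) x + c * be * rip x x.
    rewrite -affine_fcalc.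
    apply: fcalc_le sY fP (fcalc_horner _ _) _ x => s /(between_spectrum YmM)/andP[ms _].
    have s0 := lt_le_trans mM_gt0 ms.
    rewrite hornerD hornerZ hornerX hornerC -{1}(divfK (lt0r_neq0 ka_gt0) s).
    rewrite powRM ?(ltW ka_gt0) //; last first.
      by rewrite divr_ge0 // ltW.
    (* The chord at [s / ka] absorbs the factor [ka] of [Y_le]. That point may lie below m/M, hence
       a chord bound valid for all positive arguments. *)
    have := chord_ge (s / ka) (divr_gt0 s0 ka_gt0).
    move=> /(ler_wpM2l (ltW c_gt0)).
    have -> : c * (kant * (s / ka) `^ t) = (s / ka) `^ t * ka `^ t.
      by rewrite /c; field; rewrite gt_eqF.
    by move=> /le_trans; apply; rewrite le_eqVlt; apply/orP; left; apply/eqP; ring.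
  have h2 : al * rip (Phi X x) x + be * rip x x <= rip (Phi Xt x) x.
    rewrite -Phi_affine; apply: positive_map_le => // [|z]; first exact: saff.
    have -> : rip ((al%:C *: X + be%:C *: (1 : bop H)) z) z
        = rip (bop_horner (al *: 'X + be%:P) X z) z.
      by rewrite affine_fcalc bopDE !bopZE bop1E ripDl !ripZl.
    apply: fcalc_le sX (fcalc_horner _ _) fXt _ z => s /(between_spectrum XmM) /chord_le.
    by rewrite !hornerE.
  have alka : 0 <= c * (al / ka).
    exact: mulr_ge0 (ltW c_gt0) (divr_ge0 al_ge0 (ltW ka_gt0)).
  have := ler_wpM2l alka (Y_le x).
  have -> : c * (al / ka) * (ka * rip (Phi X x) x) = c * al * rip (Phi X x) x.
    by field; rewrite gt_eqF.
  have := ler_wpM2l (ltW c_gt0) h2; lra.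
pose p := mu `^ t.
have p_ge1 : 1 <= p.
  rewrite [leLHS](_ : 1 = 1 `^ t); last by rewrite powR1.
  by rewrite ge0_ler_powR ?nnegrE ?(ltW mu_gt0).
have p_gt0 : 0 < p by exact: lt_le_trans p_ge1.
have Pp : between p^-1 p P by exact: between_pow.
have sP := between_sa Pp; have /self_adjointP sP' := sP.
have PAP_le x : rip (Phi A (P x)) (P x)
    <= sg * (p * mu + (p * mu)^-1) * rip (P x) x - M * m * rip (E x) x.
  have h1 : rip (Phi A (P x)) (P x) + M * m * rip (E (P x)) (P x)
      <= (M + m) * rip (P x) (P x).
    have : rip (Phi (1%:C *: A + (M * m)%:C *: V) (P x)) (P x)
        <= rip (Phi ((M + m)%:C *: (1 : bop H)) (P x)) (P x).
      apply: positive_map_le => // [|z].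
        by apply: self_adjointD; exact: self_adjointZ.
      rewrite bopDE !bopZE bop1E ripDl !ripZl mul1r.
      exact: between_add_inverse m_gt0 Amm AV.
    by rewrite Phi_comb linearZ bopZE Phi_unital bop1E ripZl mul1r.
  have Emu : between mu^-1 mu (sg%:C *: E).
    have muM : mu^-1 = sg * M^-1 by rewrite -mu_sg invfM mulVKf // gt_eqF.
    have mum : mu = sg * m^-1.
      by rewrite -mu_sg' invf_div mulrCA divff ?mulr1 // gt_eqF.
    split=> [|z|z]; first exact: self_adjointZ.
      by rewrite bopZE ripZl muM -mulrA ler_pM2l.
    by rewrite bopZE ripZl {1}mum -mulrA ler_pM2l.
  have := kantorovich_sandwich x p_ge1 mu_ge1 Pp Emu.
  rewrite !bopZE !ripZl -(ler_pM2l sg_gt0).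
  have -> : sg * ((mu + mu^-1) * rip (P x) (P x) - sg * rip (E (P x)) (P x)
       + sg * rip (E x) x)
    = (sg * mu + sg / mu) * rip (P x) (P x) - sg ^+ 2 * rip (E (P x)) (P x)
      + sg ^+ 2 * rip (E x) x by ring.
  by rewrite mu_sg mu_sg' sg2; lra.
pose ga := p * mu + (p * mu)^-1.
have pmu_gt0 : 0 < p * mu by rewrite mulr_gt0.
have ga_gt0 : 0 < ga by rewrite addr_gt0 ?invr_gt0.
have constE : 1 / kant ^+ 2 * ka `^ (2 * t)
    * ((M `^ (1 + t) + m `^ (1 + t)) ^+ 2 / (4 * (M `^ (1 + t) * m `^ (1 + t))))
    = c ^+ 2 * (ga ^+ 2 / 4).
  have -> : ka `^ (2 * t) = (ka `^ t) ^+ 2.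
    by rewrite mulrC powRrM -[2]/(2%:R) powR_mulrn ?powR_ge0.
  have M1t := powR_gt0 (1 + t) M_gt0; have m1t := powR_gt0 (1 + t) m_gt0.
  (* (p mu)^2 = (M/m)^(1+t), so ga^2 is the quotient of (M^(1+t) + m^(1+t))^2 by M^(1+t) m^(1+t). *)
  have pmu2 : (p * mu) ^+ 2 * m `^ (1 + t) = M `^ (1 + t).
    have -> : p * mu = mu `^ (1 + t).
      by rewrite powRD ?(gt_eqF mu_gt0) ?implybT // powRr1 ?(ltW mu_gt0) // mulrC.
    rewrite -powR_mulrn ?powR_ge0 // powRAC powR_mulrn ?(ltW mu_gt0) // mu2.
    by rewrite -powRM ?(ltW Mm_gt0) ?(ltW m_gt0) // divfK // gt_eqF.
  rewrite -pmu2 /c /ga; field.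
  by rewrite !gt_eqF.
rewrite -/sg -/ka constE.
have sXAX : self_adjoint (Xt * A * Xt) by exact: self_adjoint_conj.
apply/bop_leP; [exact: self_adjoint_conj|exact/self_adjointZ/positive_map_sa|move=> x].
rewrite bopZE ripZl !bopME sP' (le_trans (PAP_le x)) // -/ga.
have h (s : R) : 2 * s * rip (Phi Xt x) x - s ^+ 2 * rip (E x) x
    <= rip (Phi (Xt * A * Xt) x) x.
  have : rip (Phi ((2 * s)%:C *: Xt + (- s ^+ 2)%:C *: V) x) x
      <= rip (Phi (Xt * A * Xt) x) x.
    apply: positive_map_le => // [|z].
      by apply: self_adjointD; exact: self_adjointZ.
    rewrite bopDE !bopZE ripDl !ripZl mulNr.
    exact: sandwich_ge sA (between_ge0 (ltW m_gt0) Amm) sXt AV.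
  by rewrite Phi_comb mulNr.
have cga : 0 <= c ^+ 2 * (ga ^+ 2 / 4) by rewrite mulr_ge0 ?divr_ge0 ?sqr_ge0.
(* Matching coefficients in Const * (2 s Phi(X^t) - s^2 E) = sg ga c Phi(X^t) - sg^2 E determines
   both this [s] and Const = c^2 ga^2 / 4. *)
pose s := 2 * sg / (c * ga).
apply: le_trans (ler_wpM2l cga (h s)).
have -> : c ^+ 2 * (ga ^+ 2 / 4) * (2 * s * rip (Phi Xt x) x - s ^+ 2 * rip (E x) x)
  = sg * ga * (c * rip (Phi Xt x) x) - sg ^+ 2 * rip (E x) x.
  by rewrite /s; field; rewrite (gt_eqF c_gt0) (gt_eqF ga_gt0).
by rewrite sg2 lerD2r ler_pM2l ?mulr_gt0.
Qed.
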